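(* Let $T>0$, $n\ge 1$ and $H:[0,T]\times\mathbb{R}^n\times\mathbb{R}^n\to\mathbb{R}$. Put $L(t,x,v):=\sup_{p\in\mathbb{R}^n}\{\langle v,p\rangle-H(t,x,p)\}\in\mathbb{R}\cup\{+\infty\}$, i.e. $L(t,x,\cdot)=H^*(t,x,\cdot)$. Assume: 1. $t\mapsto H(t,x,p)$ is Lebesgue measurable for all $x,p\in\mathbb{R}^n$; $(x,p)\mapsto H(t,x,p)$ is continuous for every $t\in[0,T]$; $p\mapsto H(t,x,p)$ is convex for all $(t,x)\in[0,T]\times\mathbb{R}^n$. 2. There is a measurable $c:[0,T]\to[0,+\infty)$ such that $|H(t,x,p)-H(t,x,q)|\le c(t)(1+|x|)|p-q|$ for all $t\in[0,T]$, $x,p,q\in\mathbb{R}^n$. 3. For every $R>0$ there is a measurable $k_R:[0,T]\to[0,+\infty)$ such that $|H(t,x,p)-H(t,y,p)|\le k_R(t)(1+|p|)|x-y|$ for all $t\in[0,T]$, $x,y\in\mathbb{B}_R$, $p\in\mathbb{R}^n$. 4. There is $\lambda:[0,T]\times\mathbb{R}^n\to\mathbb{R}$, measurable in $t$ for every $x$ and continuous in $x$ for every $t$, such that $L(t,x,v)\le\lambda(t,x)$ for all $(t,x)\in[0,T]\times\mathbb{R}^n$ and $v\in\operatorname{dom}L(t,x,\cdot)$, and such that for every $R>0$ and $t\in[0,T]$ the function $\lambda(t,\cdot)$ is $k_R(t)$-Lipschitz on $\mathbb{B}_R$. Let $\mathbb{B}$ denote the closed unit ball in $\mathbb{R}^{n+1}$.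 Then there exist $f:[0,T]\times\mathbb{R}^n\times\mathbb{B}\to\mathbb{R}^n$ and $l:[0,T]\times\mathbb{R}^n\times\mathbb{B}\to\mathbb{R}$, measurable in $t$ for all $(x,a)\in\mathbb{R}^n\times\mathbb{B}$ and continuous in $(x,a)$ for all $t\in[0,T]$, such that for every $t\in[0,T]$ and $x,p\in\mathbb{R}^n$ $$H(t,x,p)=\sup_{a\in\mathbb{B}}\{\langle p,f(t,x,a)\rangle-l(t,x,a)\}\quad\text{and}\quad f(t,x,\mathbb{B})=\operatorname{dom}H^*(t,x,\cdot).$$ Moreover: (A1) For any $R>0$ and all $t\in[0,T]$, $x,y\in\mathbb{B}_R$, $a,b\in\mathbb{B}$, $$|f(t,x,a)-f(t,y,b)|\le 10(n+1)\big(\omega_R(t)+3(1+R)k_R(t)+1\big)\big(|x-y|+|a-b|\big),$$ $$|l(t,x,a)-l(t,y,b)|\le 10(n+1)\big(\omega_R(t)+3(1+R)k_R(t)+1\big)\big(|x-y|+|a-b|\big),$$ where $\omega_R(t):=|\lambda(t,0)|+|H(t,0,0)|+c(t)(2+R)$. (A2) $|f(t,x,a)|\le c(t)(1+|x|)$ for all $t\in[0,T]$, $x\in\mathbb{R}^n$, $a\in\mathbb{B}$. (A3) $\operatorname{gph}H^*(t,x,\cdot)\subset\bigcup_{a\in\mathbb{B}}\{(f(t,x,a),l(t,x,a))\}$ for all $t\in[0,T]$, $x\in\mathbb{R}^n$. (A4) Furthermore, if $H$, $\lambda$ and $c$ are continuous (in all variables), then so are $f$ and $l$.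
   Context: $|\cdot|$ is the Euclidean norm, $\langle\cdot,\cdot\rangle$ the inner product, and $\mathbb{B}_R$ the closed ball in $\mathbb{R}^n$ with centre $0$ and radius $R$. For an extended-real-valued function $\varphi$ on $\mathbb{R}^n$: $\operatorname{dom}\varphi=\{x:\varphi(x)\ne\pm\infty\}$ and $\operatorname{gph}\varphi=\{(x,r)\in\mathbb{R}^n\times\mathbb{R}:\varphi(x)=r\}$. $^*$ denotes the Legendre-Fenchel transform in the last variable. ''Measurable'' means Lebesgue measurable. *)

(* Defs.v *)
From HB Require Import structures.
From mathcomp Require Import all_boot all_order all_algebra.
From mathcomp Require Import all_classical all_reals all_analysis.
From mathcomp Require Import measurable_realfun.

Set Implicit Arguments.
Unset Strict Implicit.
Unset Printing Implicit Defensive.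
Import Order.TTheory GRing.Theory Num.Theory.
Import numFieldNormedType.Exports.
Local Open Scope classical_set_scope.
Local Open Scope ring_scope.

(* The norm that the library puts on 'rV[R]_n is the sup norm, so the Euclidean
   norm is defined here; the topology of 'rV[R]_n is the same for both. *)
Definition dotv (R : realType) (n : nat) (u v : 'rV[R]_n) : R :=
  \sum_(i < n) u ord0 i * v ord0 i.

Definition enorm (R : realType) (n : nat) (u : 'rV[R]_n) : R :=
  Num.sqrt (dotv u u).

Definition eball (R : realType) (n : nat) (r : R) : set 'rV[R]_n :=
  [set u | enorm u <= r].

Definition fenchel (R : realType) (n : nat) (phi : 'rV[R]_n -> R)
    (v : 'rV[R]_n) : \bar R :=
  ereal_sup [set (dotv v p - phi p)%:E | p in [set: 'rV[R]_n]].

Definition edom (R : realType) (n : nat) (phi : 'rV[R]_n -> \bar R) :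
    set 'rV[R]_n :=
  [set v | phi v <> +oo%E /\ phi v <> -oo%E].

Definition egph (R : realType) (n : nat) (phi : 'rV[R]_n -> \bar R) :
    set ('rV[R]_n * R) :=
  [set z | phi z.1 = z.2%:E].

(* R with the sigma-algebra of Lebesgue measurable sets; the default one of the
   library, on measurableTypeR R, consists of the Borel sets only. *)
Definition lebesgueType (R : realType) :=
  g_sigma_algebraType (completed_algebra_gen (@lebesgue_measure R)).

Definition borel_rV (R : realType) (n : nat) :=
  g_sigma_algebraType (@open 'rV[R]_n).

Definition lmeasurable (R : realType) (D : set R) (g : R -> R) : Prop :=
  @measurable_fun _ _ (lebesgueType R) (measurableTypeR R) D g.

Definition lmeasurable_rV (R : realType) (n : nat) (D : set R)
    (g : R -> 'rV[R]_n) : Prop :=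
  @measurable_fun _ _ (lebesgueType R) (borel_rV R n) D g.

(* Main.v *)
Require Import Defs.
From mathcomp Require Import all_boot all_order all_algebra.
From mathcomp Require Import all_classical all_reals all_analysis.
From mathcomp Require Import measurable_realfun.
From mathcomp Require Import ring lra.
Import Order.TTheory GRing.Theory Num.Theory.
Import numFieldNormedType.Exports.
Local Open Scope classical_set_scope.
Local Open Scope ring_scope.

Set Implicit Arguments.
Unset Strict Implicit.
Unset Printing Implicit Defensive.

(* For fixed (t, x) the set E = {(v, r) : L(t,x,v) <= r <= lambda(t,x)} is a
   compact convex subset of R^(n+1) containing the graph of L(t,x,.), and it is
   handled only through its support function h.  By duality h(p,-s) = s H(t,x,p/s)
   for s > 0 and h(p,r) = h(p,0) + lambda(t,x) r for r >= 0, so h inherits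
   measurability in t and Lipschitz or continuous dependence on (t,x) from H and
   lambda.

   E is the image of the unit ball under a |-> y + q(E_y), where y = rho a, rho
   bounds the norm on E, E_y is the intersection of E - y with the ball of radius
   three times the distance from 0 to E - y, and q selects a point of a convex
   body.  If y is in E then E_y = {0} and y is fixed.  The support function of E_y is
   an inf-convolution, and it is 9-Lipschitz in that of E - y.

   The Steiner point could serve as q; averaging the gradient of the support
   function over the cube [-1,1]^m instead of the ball gives a selection that is
   still m-Lipschitz but is a limit of finite linear combinations of values of the
   support function.  As 9 m + 1 <= 10 m, the constant 10 (n+1) results.

   The same selection applied to a directional derivative yields the subgradients
   of H on which the duality rests. *)

(** * Euclidean inner product and norm *)

Section Euclidean.
Variables (R : realType) (m : nat).
Implicit Types (u v w : 'rV[R]_m) (s : R) (i : 'I_m).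

Lemma dotvC u v : dotv u v = dotv v u.
Proof. by apply: eq_bigr => i _; rewrite mulrC. Qed.

Lemma dotvDl u v w : dotv (u + v) w = dotv u w + dotv v w.
Proof. by rewrite /dotv -big_split /=; apply: eq_bigr => i _; rewrite mxE mulrDl. Qed.

Lemma dotvZl s u w : dotv (s *: u) w = s * dotv u w.
Proof. by rewrite /dotv mulr_sumr; apply: eq_bigr => i _; rewrite mxE mulrA. Qed.

Lemma dotvNl u w : dotv (- u) w = - dotv u w.
Proof. by rewrite -scaleN1r dotvZl mulN1r. Qed.

Lemma dotvBl u v w : dotv (u - v) w = dotv u w - dotv v w.
Proof. by rewrite dotvDl dotvNl. Qed.

Lemma dotv0l w : dotv 0 w = 0.
Proof. by rewrite -(scale0r 0) dotvZl mul0r. Qed.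

Lemma dotvDr u v w : dotv w (u + v) = dotv w u + dotv w v.
Proof. by rewrite dotvC dotvDl !(dotvC w). Qed.

Lemma dotvZr s u w : dotv w (s *: u) = s * dotv w u.
Proof. by rewrite dotvC dotvZl (dotvC w). Qed.

Lemma dotvNr u w : dotv w (- u) = - dotv w u.
Proof. by rewrite dotvC dotvNl (dotvC w). Qed.

Lemma dotvBr u v w : dotv w (u - v) = dotv w u - dotv w v.
Proof. by rewrite dotvDr dotvNr. Qed.

Lemma dotv0r w : dotv w 0 = 0.
Proof. by rewrite dotvC dotv0l. Qed.

Lemma dotvv_ge0 u : 0 <= dotv u u.
Proof. by apply: sumr_ge0 => i _; rewrite -expr2 sqr_ge0. Qed.

Lemma enorm_ge0 u : 0 <= enorm u.
Proof. exact: sqrtr_ge0. Qed.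

Lemma enorm_sqr u : enorm u ^+ 2 = dotv u u.
Proof. by rewrite sqr_sqrtr // dotvv_ge0. Qed.

Lemma enorm0 : enorm (0 : 'rV[R]_m) = 0.
Proof. by rewrite /enorm dotv0l sqrtr0. Qed.

Lemma enormZ s u : enorm (s *: u) = `|s| * enorm u.
Proof.
by rewrite /enorm dotvZl dotvZr mulrA -expr2 sqrtrM ?sqr_ge0// sqrtr_sqr.
Qed.

Lemma enormN u : enorm (- u) = enorm u.
Proof. by rewrite -scaleN1r enormZ normrN1 mul1r. Qed.

Lemma enormBC u v : enorm (u - v) = enorm (v - u).
Proof. by rewrite -enormN opprB. Qed.

Lemma coord_le_enorm u i : `|u ord0 i| <= enorm u.
Proof.
rewrite -(ler_pXn2r (ltn0Sn 1)) ?nnegrE ?enorm_ge0// enorm_sqr real_normK ?num_real//.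
rewrite /dotv (bigD1 i)//= -expr2 lerDl.
by apply: sumr_ge0 => j _; rewrite -expr2 sqr_ge0.
Qed.

Lemma enorm_eq0 u : enorm u = 0 -> u = 0.
Proof.
move=> u0; apply/rowP => i; rewrite mxE; apply/eqP.
by rewrite -normr_le0 -u0 coord_le_enorm.
Qed.

Lemma cauchy_schwarz u v : dotv u v <= enorm u * enorm v.
Proof.
have [->|v0] := eqVneq v 0; first by rewrite dotv0r enorm0 mulr0.
have nv : 0 < enorm v.
  by rewrite lt_def enorm_ge0 andbT; apply: contra_neq v0 => /enorm_eq0.
(* This vector is [dotv v v] times the component of [u] orthogonal to [v]; dividing its squared norm
   by the square of [enorm v] leaves the inequality. *)
have := dotvv_ge0 (dotv v v *: u - dotv u v *: v).
rewrite dotvBl !dotvBr !dotvZl !dotvZr (dotvC v u) -!enorm_sqr => H.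
have {}H : 0 <= enorm v ^+ 2 * ((enorm u * enorm v) ^+ 2 - dotv u v ^+ 2).
  by apply: le_trans H _; rewrite le_eqVlt; apply/orP; left; apply/eqP; ring.
have {}H : dotv u v ^+ 2 <= (enorm u * enorm v) ^+ 2.
  by rewrite -subr_ge0 -(pmulr_rge0 _ (exprn_gt0 2 nv)).
apply: le_trans (ler_norm _) _.
by rewrite -(ler_pXn2r (ltn0Sn 1)) ?nnegrE ?mulr_ge0 ?enorm_ge0// real_normK ?num_real.
Qed.

Lemma cauchy_schwarz_norm u v : `|dotv u v| <= enorm u * enorm v.
Proof.
by rewrite ler_norml cauchy_schwarz lerNl -dotvNl andbT (le_trans (cauchy_schwarz _ _))// enormN.
Qed.

Lemma enormD u v : enorm (u + v) <= enorm u + enorm v.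
Proof.
rewrite -(ler_pXn2r (ltn0Sn 1)) ?nnegrE ?addr_ge0 ?enorm_ge0// enorm_sqr.
rewrite dotvDl !dotvDr (dotvC v u) -!enorm_sqr sqrrD.
have := cauchy_schwarz u v; lra.
Qed.

Lemma enormB_triangle w u v : enorm (u - v) <= enorm (u - w) + enorm (w - v).
Proof. by rewrite (le_trans _ (enormD _ _))// addrA subrK. Qed.

Lemma enorm_le_sum u : enorm u <= \sum_i `|u ord0 i|.
Proof.
rewrite -(ler_pXn2r (ltn0Sn 1)) ?nnegrE ?enorm_ge0 ?sumr_ge0// enorm_sqr /dotv.
rewrite expr2 mulr_suml ler_sum// => i _.
rewrite (le_trans (ler_norm _))// normrM ler_wpM2l// (bigD1 i)//= lerDl sumr_ge0//.
Qed.

Lemma enorm_le_coord u (b : R) : 0 <= b -> (forall i, `|u ord0 i| <= b) ->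
  enorm u <= Num.sqrt m%:R * b.
Proof.
move=> b0 ub; rewrite -(ler_pXn2r (ltn0Sn 1)) ?nnegrE ?mulr_ge0 ?enorm_ge0 ?sqrtr_ge0//.
rewrite enorm_sqr exprMn sqr_sqrtr// mulr_natl.
rewrite (_ : b ^+ 2 *+ m = \sum_(i < m) b ^+ 2); last by rewrite sumr_const card_ord.
apply: ler_sum => i _; rewrite -expr2 -real_normK ?num_real//.
by rewrite ler_pXn2r ?nnegrE.
Qed.

Definition axis (i : 'I_m) : 'rV[R]_m := \row_j (j == i)%:R.

Lemma dotv_axis u i : dotv u (axis i) = u ord0 i.
Proof.
rewrite /dotv (bigD1 i)//= mxE eqxx mulr1 big1 ?addr0// => j ji.
by rewrite mxE (negbTE ji) mulr0.
Qed.

Lemma enorm_axis i : enorm (axis i) = 1.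
Proof. by rewrite /enorm dotv_axis mxE eqxx sqrtr1. Qed.

Lemma row_sum_axis u : u = \sum_i u ord0 i *: axis i.
Proof.
apply/rowP => j; rewrite summxE (bigD1 j)//= !mxE eqxx mulr1 big1 ?addr0// => i ij.
by rewrite !mxE eq_sym (negbTE ij) mulr0.
Qed.

End Euclidean.

(** * Averages over cubic grids *)

Section Averages.
Variables (R : realType) (m : nat).
Implicit Types (u v w : 'rV[R]_m) (g : 'rV[R]_m -> R) (k i : 'I_m) (N : nat).

(** A Riemann sum for the mean of [g] along axis [k] over [-1,1]; the nodes are the left ends of [N]
    equal intervals. *)
Definition avg N k g u : R :=
  N%:R^-1 * \sum_(j < N) g (u + (2 * j%:R / N%:R - 1) *: axis R k).

(** The exact mean over [-1,1] of the partial derivative along axis [k], written so that no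
    derivative has to exist. *)
Definition cdiff k g u : R := (g (u + axis R k) - g (u - axis R k)) / 2.

Definition avgs N (s : seq 'I_m) g := foldr (avg N) g s.

Definition dop N i k := if k == i then cdiff k else avg N k.

(* By avgs_step, davgs N i s g is a difference quotient of avgs N s g along axis i;
   it plays the role of the i-th partial derivative. *)
Definition davgs N i (s : seq 'I_m) g := foldr (dop N i) g s.

Definition shift_bounded w (b : R) g := forall u, `|g (u + w) - g u| <= b.

Definition convexf g := forall u v (t : R), 0 <= t <= 1 ->
  g (t *: u + (1 - t) *: v) <= t * g u + (1 - t) * g v.

Lemma node_range N (j : 'I_N) : `|2 * j%:R / N%:R - 1 : R| <= 1.
Proof.
have N0 : (0 < N)%N by exact: leq_ltn_trans (ltn_ord j).
have NR : 0 < N%:R :> R by rewrite ltr0n.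
have j0 : 0 <= j%:R / N%:R :> R by rewrite divr_ge0.
have j1 : j%:R / N%:R <= 1 :> R by rewrite ler_pdivrMr// mul1r ler_nat ltnW.
rewrite ler_norml; apply/andP; split; lra.
Qed.

Lemma avg_cst N (b : R) : (0 < N)%N -> N%:R^-1 * \sum_(j < N) b = b.
Proof.
by move=> N0; rewrite sumr_const card_ord -(mulr_natl b) mulrA mulVf ?mul1r ?pnatr_eq0 -?lt0n.
Qed.

Lemma avg_dist N k g g' u u' (b : R) : (0 < N)%N ->
  (forall s : R, `|s| <= 1 -> `|g (u + s *: axis R k) - g' (u' + s *: axis R k)| <= b) ->
  `|avg N k g u - avg N k g' u'| <= b.
Proof.
move=> N0 gb; rewrite /avg -mulrBr -sumrB normrM ger0_norm ?invr_ge0//.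
rewrite -[leRHS](avg_cst _ N0) ler_wpM2l ?invr_ge0// (le_trans (ler_norm_sum _ _ _))//.
by apply: ler_sum => j _; apply: gb; exact: node_range.
Qed.

Lemma cdiff_dist k g g' u u' (b : R) :
  (forall s : R, `|s| <= 1 -> `|g (u + s *: axis R k) - g' (u' + s *: axis R k)| <= b) ->
  `|cdiff k g u - cdiff k g' u'| <= b.
Proof.
move=> gb; rewrite /cdiff.
have := gb 1 _; rewrite normr1 !scale1r => /(_ (lexx _)).
have := gb (-1) _; rewrite normrN1 !scaleN1r => /(_ (lexx _)).
by rewrite !ler_norml => /andP[? ?] /andP[? ?]; apply/andP; split; lra.
Qed.

Lemma dop_dist N i k g g' u u' (b : R) : (0 < N)%N ->
  (forall s : R, `|s| <= 1 -> `|g (u + s *: axis R k) - g' (u' + s *: axis R k)| <= b) ->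
  `|dop N i k g u - dop N i k g' u'| <= b.
Proof. by rewrite /dop; case: ifP => _ N0; [exact: cdiff_dist|exact: avg_dist]. Qed.

Lemma davgs_shift_bounded N i s g w (b : R) : (0 < N)%N ->
  shift_bounded w b g -> shift_bounded w b (davgs N i s g).
Proof.
move=> N0 gb; elim: s => //= k s IH u; apply: dop_dist => // t _.
by rewrite addrAC; exact: IH.
Qed.

Lemma avgs_shift N s g w (b : R) : (0 < N)%N ->
  (forall u, g (u + w) <= g u + b) -> forall u, avgs N s g (u + w) <= avgs N s g u + b.
Proof.
move=> N0 gb; elim: s => //= k s IH u; rewrite /avg -[X in _ <= _ + X](avg_cst b N0) -mulrDr -big_split/=.
rewrite ler_wpM2l ?invr_ge0// ler_sum// => j _; rewrite addrAC; exact: IH.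
Qed.

Lemma avgs_convex N s g : (0 < N)%N -> convexf g -> convexf (avgs N s g).
Proof.
move=> N0 cg; elim: s => //= k s IH u v t t01; rewrite /avg.
rewrite mulrCA (mulrCA (1 - t)) -mulrDr ler_wpM2l ?invr_ge0//.
rewrite !mulr_sumr -big_split/= ler_sum// => j _.
apply: le_trans (IH _ _ _ t01); rewrite !scalerDr addrACA -scalerDl.
by rewrite (_ : t + (1 - t) = 1) ?scale1r//; ring.
Qed.

(** Each axis of [s] is used once, so [g] is sampled only in a cube of half-side 1 around [u].
    Uniqueness of [s] prevents a coordinate from moving twice. *)
Lemma davgs_local_dist N i s g g' u (b : R) : (0 < N)%N -> uniq s ->
  (forall v, (forall j, `|v ord0 j - u ord0 j| <= (j \in s)%:R) -> `|g v - g' v| <= b) ->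
  `|davgs N i s g u - davgs N i s g' u| <= b.
Proof.
move=> N0; elim: s u => [|k s IH] u /=.
  by move=> _; apply => j; rewrite subrr normr0.
case/andP => ks us gb; apply: dop_dist => // t t1; apply: IH => // v vs.
apply: gb => j; have := vs j; rewrite !mxE inE.
have [->|jk] /= := eqVneq j k; last by rewrite mulr0 addr0.
rewrite (negbTE ks) normr_le0 mulr1 subr_eq0 => /eqP ->.
by rewrite addrAC subrr add0r.
Qed.

Lemma eq_avgs_davgs N i s g : i \notin s -> davgs N i s g = avgs N s g.
Proof.
elim: s => //= k s IH; rewrite inE negb_or => /andP[ik /IH ->].
by rewrite /dop eq_sym (negbTE ik).
Qed.

(* Averaging over a grid of step 2/N makes the forward difference of the same
   step telescope to the central difference between the two end faces. *)
Lemma avg_step N k g u : (0 < N)%N ->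
  avg N k g (u + (2 / N%:R) *: axis R k) - avg N k g u = 2 / N%:R * cdiff k g u.
Proof.
move=> N0; have NR : N%:R != 0 :> R by rewrite pnatr_eq0 -lt0n.
pose F (j : nat) := g (u + (2 * j%:R / N%:R - 1) *: axis R k).
rewrite /avg -mulrBr -sumrB.
rewrite (eq_bigr (fun j : 'I_N => F j.+1 - F j)); last first.
  move=> j _; congr (g _ - _); rewrite -addrA -scalerDl; congr (_ + _ *: _).
  by rewrite -natr1; field.
rewrite -(big_mkord xpredT (fun j => F j.+1 - F j)) telescope_sumr// /F.
rewrite mulfK// mulr0 mul0r sub0r scaleN1r (_ : 2 - 1 = 1 :> R); last by ring.
by rewrite scale1r /cdiff; field.
Qed.

Lemma avgs_step N i s g u : (0 < N)%N -> uniq s -> i \in s ->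
  avgs N s g (u + (2 / N%:R) *: axis R i) - avgs N s g u =
  2 / N%:R * davgs N i s g u.
Proof.
move=> N0; elim: s u => //= k s IH u /andP[ks us]; rewrite inE /dop.
case: (eqVneq i k) ks => [<- ks _|ik ks /= is_].
  by rewrite avg_step// eq_avgs_davgs.
rewrite /avg -mulrBr -sumrB [RHS]mulrCA; congr (_ * _); rewrite mulr_sumr.
apply: eq_bigr => j _; rewrite addrAC IH//.
Qed.

(** Even nodes of the fine grid are the nodes of the coarse one, and each odd node lies 1/N beyond
    an even one, so the mean of a pair is off by at most L/(2N). *)
Lemma avg_double N k g u (L : R) : (0 < N)%N ->
  (forall u v, `|g u - g v| <= L * enorm (u - v)) ->
  `|avg (N * 2) k g u - avg N k g u| <= L / N%:R.
Proof.
move=> N0 gL; have NR : 0 < N%:R :> R by rewrite ltr0n.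
have L0 : 0 <= L.
  by have := gL (axis R k) 0; rewrite subr0 enorm_axis mulr1; exact: le_trans.
pose F (j : nat) := g (u + (2 * j%:R / (N * 2)%:R - 1) *: axis R k).
have split2 n : \sum_(j < n * 2) F j = \sum_(j < n) (F (j * 2)%N + F (j * 2).+1).
  elim: n => [|n IH]; first by rewrite mul0n !big_ord0.
  by rewrite mulSn !add2n !big_ord_recr /= IH addrA.
rewrite /avg split2 natrM invfM -mulrA -mulrBr normrM ger0_norm ?invr_ge0//.
rewrite mulrC ler_wpM2r ?invr_ge0//.
rewrite mulr_sumr -sumrB (le_trans (ler_norm_sum _ _ _))//.
rewrite -[leRHS](avg_cst _ N0) mulr_sumr ler_sum// => j _.
have -> : F (j * 2)%N = g (u + (2 * j%:R / N%:R - 1) *: axis R k).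
  congr (g (_ + _ *: _)); rewrite !natrM; field; exact: lt0r_neq0.
set a := g _; rewrite (_ : _ - a = (F (j * 2).+1 - a) / 2); last by field.
have : `|F (j * 2).+1 - a| <= L * N%:R^-1.
  rewrite (le_trans (gL _ _))// opprD addrACA subrr add0r -scalerBl enormZ enorm_axis mulr1.
  rewrite ler_wpM2l// ger0_norm -natr1 !natrM.
    by rewrite le_eqVlt; apply/orP; left; apply/eqP; field; exact: lt0r_neq0.
  rewrite (_ : _ - _ = N%:R^-1) ?invr_ge0//; field; exact: lt0r_neq0.
rewrite normrM (@ger0_norm _ 2^-1)// (mulrC _ L) => H.
have : 0 <= `|F (j * 2).+1 - a| by []. 
lra.
Qed.

End Averages.

(** * The averaged gradient as a Lipschitz selection *)

Section Steiner.
Variables (R : realType) (m : nat).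
Implicit Types (u v w : 'rV[R]_m) (h : 'rV[R]_m -> R) (N : nat) (L : R).

Definition lipf L h := forall u v, `|h u - h v| <= L * enorm (u - v).

Definition sublin h :=
  (forall u v, h (u + v) <= h u + h v) /\ (forall s u, 0 <= s -> h (s *: u) = s * h u).

Lemma sublin0 h : sublin h -> h 0 = 0.
Proof. by case=> _ /(_ 0 0 (lexx _)); rewrite scale0r mul0r. Qed.

Lemma sublin_lipf L h : sublin h -> (forall u, h u <= L * enorm u) -> lipf L h.
Proof.
move=> [hD _] hL u v.
have := hD v (u - v); rewrite subrKC => h1.
have := hD u (v - u); rewrite subrKC => h2.
have := hL (u - v); have := hL (v - u); rewrite enormBC => h3 h4.
by rewrite ler_norml; apply/andP; split; lra.
Qed.

Lemma sublin_convexf h : sublin h -> convexf h.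
Proof.
move=> [hD hZ] u v t /andP[t0 t1]; rewrite (le_trans (hD _ _))// !hZ//; lra.
Qed.

Lemma lipf_shift_bounded L h w : lipf L h -> shift_bounded w (L * enorm w) h.
Proof. by move=> hL u; rewrite (le_trans (hL _ _))// addrAC subrr add0r. Qed.

Lemma lipf_davgs N i s L h : (0 < N)%N -> lipf L h -> lipf L (davgs N i s h).
Proof.
move=> N0 hL u v.
have := davgs_shift_bounded i s N0 (lipf_shift_bounded (u - v) hL) v.
by rewrite subrKC.
Qed.

Lemma lipf_ge0 L h (i : 'I_m) : lipf L h -> 0 <= L.
Proof.
by move/(_ (axis R i) 0); rewrite subr0 enorm_axis mulr1; exact: le_trans.
Qed.

(** The grid is refined one axis at a time. Each averaged axis costs at most [L / N]; the central
    difference does not depend on [N] and costs nothing. *)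
Lemma davgs_double N i s L h u : (0 < N)%N -> lipf L h ->
  `|davgs (N * 2) i s h u - davgs N i s h u| <= (size s)%:R * (L / N%:R).
Proof.
move=> N0 hL; elim: s u => [|k s IH] u /=; first by rewrite subrr normr0 mul0r.
have N20 : (0 < N * 2)%N by rewrite muln_gt0 N0.
have L0 := lipf_ge0 k hL.
apply: le_trans (ler_distD (dop (N * 2) i k (davgs N i s h) u) _ _) _.
rewrite -natr1 mulrDl mul1r lerD//.
  by apply: dop_dist => // t _; exact: IH.
rewrite /dop; case: ifP => _; last exact: avg_double (lipf_davgs _ _ _ _).
by rewrite subrr normr0 divr_ge0.
Qed.

Lemma cvgn_geometric_steps (a : R^nat) (C : R) :
  (forall J, `|a J.+1 - a J| <= C / (2 ^ J)%:R) -> cvgn a.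
Proof.
move=> aC.
have C0 : 0 <= C by have := aC 0; rewrite expn0 divr1; exact: le_trans.
have p2 J : (2 ^ J)%:R != 0 :> R by rewrite pnatr_eq0 expn_eq0.
have halve J : C / (2 ^ J)%:R = 2 * (C / (2 ^ J.+1)%:R).
  by rewrite expnS natrM; field.
(* The sum of all step bounds from [J] on. It makes [a - b] nondecreasing and [a + b] nonincreasing,
   so monotone convergence applies to [a - b]. *)
pose b J := 2 * C / (2 ^ J)%:R.
have b0 : b @ \oo --> 0.
  have -> : b = geometric (2 * C) 2^-1.
    by apply/funext => J; rewrite /b /geometric/= natrX exprVn.
  by apply: cvg_geometric; rewrite ger0_norm ?invf_lt1// ltr1n.
have bge J : 0 <= b J by rewrite divr_ge0// mulr_ge0.
have stepL J : a J - b J <= a J.+1 - b J.+1.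
  have := aC J; rewrite ler_norml => /andP[+ _]; rewrite /b -!mulrA halve; lra.
have stepR J : a J.+1 + b J.+1 <= a J + b J.
  have := aC J; rewrite ler_norml => /andP[_]; rewrite /b -!mulrA halve; lra.
have : cvgn (a - b).
  apply: nondecreasing_is_cvgn; first by apply/nondecreasing_seqP.
  exists (a 0 + b 0) => _ [J _ <-].
  have : a J + b J <= a 0 + b 0 by elim: J => // J; exact: le_trans.
  by have := bge J; rewrite !fctE; lra.
move=> ab; rewrite (_ : a = (a - b) + b); last by apply/funext => J; rewrite !fctE subrK.
by apply: is_cvgD => //; apply/cvg_ex; exists 0.
Qed.

Lemma limn_dist_le (a b : R^nat) (e : R) : cvgn a -> cvgn b ->
  (forall J, `|a J - b J| <= e) -> `|limn a - limn b| <= e.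
Proof.
move=> ca cb abe.
have cab : `|(a - b) x| @[x --> \oo] --> `|limn a - limn b|.
  by apply: cvg_norm; exact: cvgB.
have ce : (fun=> e) x @[x --> \oo] --> e by exact: cvg_cst.
by apply: (ler_cvg_to cab ce); apply: nearW => J; exact: abe.
Qed.

(* The average of the gradient of h over the cube [-1,1]^m. *)
Definition steiner h : 'rV[R]_m :=
  \row_i limn (fun J => davgs (2 ^ J) i (index_enum 'I_m) h 0).

Lemma cvgn_steiner L h i : lipf L h ->
  cvgn (fun J => davgs (2 ^ J) i (index_enum 'I_m) h 0).
Proof.
move=> hL; apply: (@cvgn_geometric_steps _ ((size (index_enum 'I_m))%:R * L)) => J.
by rewrite expnSr -mulrA; apply: davgs_double => //; rewrite expn_gt0.
Qed.

(** Sample points lie in the cube, where the norm is at most the square root of m, so each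
    coordinate moves by at most that root times [e]; passing from coordinates to the norm gives the
    second root. *)
Lemma steiner_dist L L' (e : R) h h' : lipf L h -> lipf L' h' -> 0 <= e ->
  (forall u, `|h u - h' u| <= e * enorm u) ->
  enorm (steiner h - steiner h') <= m%:R * e.
Proof.
move=> hL hL' e0 he.
have -> : m%:R * e = Num.sqrt m%:R * (Num.sqrt m%:R * e).
  by rewrite mulrA -expr2 sqr_sqrtr.
apply: enorm_le_coord => [|i]; first by rewrite mulr_ge0 ?sqrtr_ge0.
rewrite !mxE; apply: limn_dist_le => [||J]; [exact: cvgn_steiner hL|exact: cvgn_steiner hL'|].
apply: davgs_local_dist => [||v v1]; rewrite ?expn_gt0 ?index_enum_uniq//.
apply: le_trans (he v) _; rewrite mulrC ler_wpM2r//.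
rewrite -[leRHS]mulr1; apply: enorm_le_coord => // j.
by have := v1 j; rewrite mem_index_enum !mxE subr0.
Qed.

(** Slopes of a convex function increase. For [t < 0] the slope over the step is at most [Q x],
    without error; for [t >= 0] it is at least [Q (x - d *: e)], and replacing that by [Q x] costs
    [C * d ^+ 2]. *)
Lemma convex_step_le (F : 'rV[R]_m -> R) x e (d t : R) (Q : 'rV[R]_m -> R) C :
  convexf F -> 0 < d -> (forall u, F (u + d *: e) - F u = d * Q u) ->
  (forall u, `|Q (u - d *: e) - Q u| <= C * d) -> `|t| <= d ->
  F x + t * Q x - C * d ^+ 2 <= F (x + t *: e).
Proof.
move=> cF d0 FQ QC td.
have C0 : 0 <= C by rewrite -(pmulr_lge0 _ d0); exact: le_trans (QC 0).
have [t0|t0] := leP 0 t.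
  have dt0 : 0 < t + d by lra.
  have := cF (x - d *: e) (x + t *: e) (t / (t + d)).
  rewrite divr_ge0 ?(ltW dt0)//= ler_pdivrMr// mul1r lerDl (ltW d0) => /(_ isT).
  rewrite (_ : 1 - t / (t + d) = d / (t + d)); last by field; exact: lt0r_neq0.
  rewrite (_ : _ *: _ + _ *: _ = x); last first.
    rewrite !scalerDr addrACA -scalerDl scalerN !scalerA -mulrDl divff ?lt0r_neq0//.
    by rewrite scale1r mulrAC (mulrAC d) (mulrC d t) addNr addr0.
  rewrite !(mulrAC _ (_^-1)) -mulrDl ler_pdivlMr// => cx.
  have := FQ (x - d *: e); rewrite subrK => Fx.
  have := QC x; rewrite ler_norml => /andP[Q1 _].
  have H1 : d * (F (x + t *: e) - F x) >= d * (t * Q (x - d *: e)) by nra.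
  have H2 : t * Q (x - d *: e) <= F (x + t *: e) - F x by rewrite -(ler_pM2l d0).
  have td' : t <= d by rewrite (le_trans (ler_norm _)).
  have H3 : t * (Q x - Q (x - d *: e)) <= t * (C * d) by rewrite ler_wpM2l//; lra.
  have H4 : t * (C * d) <= d * (C * d) by rewrite ler_wpM2r// mulr_ge0// ltW.
  nra.
have dt0 : 0 < d - t by lra.
have := cF (x + d *: e) (x + t *: e) (- t / (d - t)).
rewrite divr_ge0 ?(ltW dt0)//=; last by lra.
rewrite ler_pdivrMr// mul1r lerDr (ltW d0) => /(_ isT).
rewrite (_ : 1 - - t / (d - t) = d / (d - t)); last by field; exact: lt0r_neq0.
rewrite (_ : _ *: _ + _ *: _ = x); last first.
  rewrite !scalerDr addrACA -scalerDl !scalerA -mulrDl -scalerDl.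
  rewrite (_ : (- t + d) / (d - t) = 1); last by field; exact: lt0r_neq0.
  rewrite (_ : _ * d + _ = 0); last by field; exact: lt0r_neq0.
  by rewrite scale1r scale0r addr0.
rewrite !(mulrAC _ (_^-1)) -mulrDl ler_pdivlMr// => cx.
have Fx := FQ x.
have H1 : d * (F (x + t *: e) - F x) >= d * (t * Q x) by nra.
have H2 : t * Q x <= F (x + t *: e) - F x by rewrite -(ler_pM2l d0).
nra.
Qed.

(** A path goes from 0 to [d *: w] one axis at a time. Each move costs [L * d ^+ 2] by convexity,
    plus the change of [Q] between 0 and the current point; the total is at most the squared number
    of axes times [L * d ^+ 2]. Subadditivity bounds the growth of the average of [h] by [d * h w],
    and division by [d] ends the proof. *)
Lemma davgs_le_sublin N L h w : (0 < N)%N -> sublin h -> lipf L h ->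
  (forall i, `|w ord0 i| <= 1) ->
  \sum_i w ord0 i * davgs N i (index_enum 'I_m) h 0 <=
  h w + (size (index_enum 'I_m))%:R ^+ 2 * L * (2 / N%:R).
Proof.
move=> N0 hs hL w1; set d := 2 / N%:R.
have d0 : 0 < d by rewrite divr_gt0// ltr0n.
set s := index_enum 'I_m; set H := avgs N s h; set Q := fun i => davgs N i s h.
have cH : convexf H by apply: avgs_convex => //; exact: sublin_convexf.
have QL i : lipf L (Q i) by exact: lipf_davgs.
have path r : let P := \sum_(i <- r) (d * w ord0 i) *: axis R i in
    (0 <= L -> enorm P <= (size r)%:R * d) /\
    H 0 + \sum_(i <- r) d * w ord0 i * Q i 0 - (size r)%:R ^+ 2 * L * d ^+ 2 <= H P.
  elim: r => [|i r [IH1 IH2]] /=.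
    by rewrite !big_nil enorm0 !mul0r expr0n/= !mul0r addr0 subr0.
  rewrite !big_cons; set P := \sum_(i <- r) _ in IH1 IH2 *.
  have L0 := lipf_ge0 i hL.
  have wd : `|d * w ord0 i| <= d by rewrite normrM (gtr0_norm d0) ler_piMr// ltW.
  split=> [_|].
    by rewrite (le_trans (enormD _ _))// enormZ enorm_axis mulr1 -natr1 mulrDl mul1r addrC lerD// IH1.
  have step : H P + d * w ord0 i * Q i P - L * d ^+ 2 <= H (P + (d * w ord0 i) *: axis R i).
    apply: convex_step_le => // [u|u].
      by rewrite /H /d avgs_step// ?index_enum_uniq ?mem_index_enum.
    rewrite (le_trans (QL _ _ _))// addrAC subrr add0r enormN enormZ enorm_axis mulr1.
    by rewrite gtr0_norm.
  have QP : `|d * w ord0 i * Q i 0 - d * w ord0 i * Q i P| <= d * (L * ((size r)%:R * d)).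
    rewrite -mulrBr normrM ler_pM// (le_trans (QL _ _ _))// sub0r enormN ler_wpM2l//.
    exact: IH1.
  rewrite (addrC _ P); apply: le_trans step.
  move: QP; rewrite ler_norml => /andP[_ QP].
  rewrite -natr1; move: IH2 QP.
  set S := \sum_(_ <- _) _; set n := (size r)%:R.
  have n0 : 0 <= n * L * d ^+ 2 by rewrite !mulr_ge0// ltW.
  nra.
have [_] := path s; rewrite -/d.
rewrite (_ : \sum_(i <- s) (d * w ord0 i) *: axis R i = d *: w); last first.
  rewrite [X in _ = d *: X]row_sum_axis scaler_sumr.
  by apply: eq_bigr => i _; rewrite scalerA.
have hd := hs.1; have := avgs_shift s N0 (w := d *: w) (b := d * h w).
rewrite -/H => /(_ h) sh.
have {}sh : H (0 + d *: w) <= H 0 + d * h w.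
  by apply: sh => u; rewrite (le_trans (hd _ _))// hs.2// ltW.
rewrite add0r in sh.
rewrite (eq_bigr (fun i => d * (w ord0 i * Q i 0))); last by move=> i _; rewrite mulrA.
rewrite -mulr_sumr => le1; rewrite -(ler_pM2l d0) mulrDr; nra.
Qed.

(** The error in the grid inequality is a constant over [2 ^ J] and vanishes in the limit. This
    places the averaged gradient in the body supported by [h]. *)
Lemma steiner_le L h w : sublin h -> lipf L h -> dotv (steiner h) w <= h w.
Proof.
move=> hs hL.
have main v : (forall i, `|v ord0 i| <= 1) -> dotv (steiner h) v <= h v.
  move=> v1; set C := (size (index_enum 'I_m))%:R ^+ 2 * L * 2.
  have cv : (fun J => \sum_i v ord0 i * davgs (2 ^ J) i (index_enum 'I_m) h 0) @ \oo -->
      dotv (steiner h) v.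
    apply: cvg_big => [|i _]; first exact: add_continuous.
    rewrite mulrC mxE; apply: cvgMr; exact: cvgn_steiner hL.
  have cb : (fun J => h v + C / (2 ^ J)%:R) @ \oo --> h v + 0.
    apply: cvgD; first exact: cvg_cst.
    have -> : (fun J => C / (2 ^ J)%:R) = geometric C 2^-1.
      by apply/funext => J; rewrite /geometric/= natrX exprVn.
    by apply: cvg_geometric; rewrite ger0_norm ?invf_lt1// ltr1n.
  rewrite addr0 in cb.
  apply: (ler_cvg_to cv cb); apply: nearW => J.
  by rewrite /C -mulrA; apply: davgs_le_sublin; rewrite ?expn_gt0.
(* Homogeneity reduces to the cube; adding 1 keeps the divisor positive when [w] is 0. *)
have n0 : 0 < enorm w + 1 by rewrite ltr_wpDl ?enorm_ge0.
rewrite -(ler_pM2l (x := (enorm w + 1)^-1)) ?invr_gt0//.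
rewrite -dotvZr -hs.2 ?invr_ge0 ?(ltW n0)//; apply: main => i.
rewrite mxE normrM gtr0_norm ?invr_gt0// mulrC ler_pdivrMr// mul1r.
by rewrite (le_trans (coord_le_enorm _ _))// lerDl.
Qed.

End Steiner.

(** * A Lipschitz selection fixing the points of the body *)

Section Selection.
Variables (R : realType) (m : nat).
Implicit Types (u v w y : 'rV[R]_m) (g h : 'rV[R]_m -> R) (L e : R).

Definition gap g : R := sup [set - g u | u in @eball R m 1].

Lemma gap_ub L g u : lipf L g -> sublin g -> enorm u <= 1 -> - g u <= gap g.
Proof.
move=> gL gs u1; apply: ub_le_sup; last by exists u.
exists `|L| => _ [v v1 <-]; have := gL v 0.
rewrite (sublin0 gs) !subr0 => H.
rewrite (le_trans (ler_norm _))// normrN (le_trans H)//.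
rewrite -[leRHS]mulr1 (le_trans (ler_wpM2r (enorm_ge0 _) (ler_norm L)))//.
by rewrite ler_wpM2l.
Qed.

Lemma gap_ge0 L g : lipf L g -> sublin g -> 0 <= gap g.
Proof.
move=> gL gs; have := gap_ub gL gs (u := 0).
by rewrite (sublin0 gs) oppr0 enorm0; apply; exact: ler01.
Qed.

Lemma gap_ge L g u : lipf L g -> sublin g -> - g u <= gap g * enorm u.
Proof.
move=> gL gs; have [->|u0] := eqVneq u 0.
  by rewrite (sublin0 gs) enorm0 mulr0 oppr0.
have nu : 0 < enorm u.
  by rewrite lt_def enorm_ge0 andbT; apply: contra_neq u0 => /enorm_eq0.
rewrite -ler_pdivrMr// mulNr mulrC -gs.2 ?invr_ge0 ?enorm_ge0//.
apply: gap_ub gL gs _.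
by rewrite enormZ ger0_norm ?invr_ge0 ?enorm_ge0// mulVf ?gt_eqF.
Qed.

Lemma gap_le g (c : R) : (forall u, enorm u <= 1 -> - g u <= c) -> gap g <= c.
Proof.
move=> gc; apply: ge_sup; last by move=> _ [u u1 <-]; exact: gc.
by exists (- g 0); exists 0 => //; rewrite /eball/= enorm0.
Qed.

Lemma gap_dist L g g' e : lipf L g' -> sublin g' -> 0 <= e ->
  (forall u, `|g u - g' u| <= e * enorm u) -> gap g <= gap g' + e.
Proof.
move=> gL gs e0 ge; apply: gap_le => u u1.
have := gap_ub gL gs u1; have := ge u; rewrite ler_norml => /andP[H _].
have : e * enorm u <= e by rewrite ler_piMr.
lra.
Qed.

(* If g is the support function of a convex body K, then gap g is the distance
   from 0 to K and clip g is the support function of K intersected with the ball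
   of radius 3 * gap g. *)
Definition clip g u : R := inf [set g w + 3 * gap g * enorm (u - w) | w in setT].

Section Clip.
Variables (L : R) (g : 'rV[R]_m -> R).
Hypotheses (gL : lipf L g) (gs : sublin g).

(** Shows that [inf] in [clip] is a genuine infimum: [- g w] is at most [gap g * enorm w], and the
    triangle inequality splits [enorm w]. At [u = 0] it also yields the lower bound 0. *)
Lemma clip_lbound u w : - (gap g * enorm u) <= g w + 3 * gap g * enorm (u - w).
Proof.
have h1 := gap_ge w gL gs; have d0 := gap_ge0 gL gs.
have : enorm w <= enorm (u - w) + enorm u.
  by have := enormD (w - u) u; rewrite subrK enormBC.
have := enorm_ge0 (u - w); nra.
Qed.

Lemma clip_le u w : clip g u <= g w + 3 * gap g * enorm (u - w).
Proof.
apply: ge_inf; last by exists w.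
by exists (- (gap g * enorm u)) => _ [v _ <-]; exact: clip_lbound.
Qed.

Lemma clip_ge u (x : R) : (forall w, x <= g w + 3 * gap g * enorm (u - w)) -> x <= clip g u.
Proof.
move=> H; apply: lb_le_inf; last by move=> _ [v _ <-].
by exists (g 0 + 3 * gap g * enorm (u - 0)); exists 0.
Qed.

Lemma clip_le_gap u : clip g u <= 3 * gap g * enorm u.
Proof. by have := clip_le u 0; rewrite (sublin0 gs) add0r subr0. Qed.

Lemma clip_le_self u : clip g u <= g u.
Proof. by have := clip_le u u; rewrite subrr enorm0 mulr0 addr0. Qed.

(** As for any inf-convolution of sublinear functions, competitors for [u] and [v] add up to a
    competitor for [u + v]. *)
Lemma clip_sublin : sublin (clip g).
Proof.
have clipZ (s : R) u : 0 < s -> clip g (s *: u) <= s * clip g u.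
  move=> s0; rewrite -ler_pdivrMl//; apply: clip_ge => w; rewrite ler_pdivrMl//.
  rewrite (le_trans (clip_le _ (s *: w)))// -scalerBr enormZ gs.2 ?(ltW s0)//.
  by rewrite gtr0_norm// le_eqVlt; apply/orP; left; apply/eqP; ring.
split=> [u v|s u].
  rewrite -lerBlDr; apply: clip_ge => w; rewrite lerBlDl -lerBlDr.
  apply: clip_ge => x; rewrite lerBlDl.
  apply: le_trans (clip_le _ (w + x)) _.
  have := gs.1 w x; have := enormD (u - w) (v - x); rewrite addrACA -opprD.
  have := gap_ge0 gL gs; nra.
rewrite le_eqVlt => /predU1P[<-|s0].
  rewrite scale0r mul0r; apply/eqP; rewrite eq_le; apply/andP; split.
    by have := clip_le_gap 0; rewrite enorm0 mulr0.
  apply: clip_ge => w; have := clip_lbound 0 w.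
  by rewrite enorm0 mulr0 oppr0.
apply/eqP; rewrite eq_le clipZ//=; have := clipZ (s^-1) (s *: u).
rewrite invr_gt0 scalerA mulVf ?gt_eqF// scale1r => /(_ s0).
by rewrite ler_pdivlMl.
Qed.

Lemma clip_lipf : lipf (3 * gap g) (clip g).
Proof. exact: sublin_lipf clip_sublin clip_le_gap. Qed.

Lemma clip_eq0 u : (forall v, 0 <= g v) -> clip g u = 0.
Proof.
move=> g0; have d0 : gap g = 0.
  apply/eqP; rewrite eq_le (gap_ge0 gL gs) andbT; apply: gap_le => v _.
  by rewrite oppr_le0.
apply/eqP; rewrite eq_le; apply/andP; split.
  by have := clip_le_gap u; rewrite d0 mulr0 mul0r.
by apply: clip_ge => w; rewrite d0 mulr0 mul0r addr0.
Qed.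

End Clip.

(** The 9 is 3 + 6: a useful competitor has [enorm w] at most [3 * enorm u], which costs 3 from
    changing [g], and [enorm (u - w)] at most [2 * enorm u], which costs 3 times 2 from changing the
    gap. *)
Lemma clip_dist_le L L' g g' e u : lipf L g -> sublin g -> lipf L' g' -> sublin g' ->
  0 <= e -> (forall v, `|g v - g' v| <= e * enorm v) ->
  clip g' u <= clip g u + 9 * e * enorm u.
Proof.
move=> gL gs gL' gs' e0 ge; rewrite -lerBlDr; apply: clip_ge => w; rewrite lerBlDr.
have d0 := gap_ge0 gL gs; have d0' := gap_ge0 gL' gs'.
have dd : gap g' <= gap g + e by apply: gap_dist gL gs e0 _ => v; rewrite distrC.
have u0 := enorm_ge0 u; have uw0 := enorm_ge0 (u - w).
have w1 : enorm w <= enorm (u - w) + enorm u.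
  by have := enormD (w - u) u; rewrite subrK enormBC.
have [near|far] := leP (enorm (u - w)) (2 * enorm u).
  apply: le_trans (clip_le gL' gs' u w) _.
  have := ge w; rewrite ler_norml => /andP[gw _].
  have : e * enorm w <= e * (3 * enorm u) by rewrite ler_wpM2l//; lra.
  have : e * enorm (u - w) <= e * (2 * enorm u) by rewrite ler_wpM2l.
  nra.
(* A competitor w this far from u is already beaten by w = 0. *)
apply: le_trans (clip_le_gap gL' gs' u) _.
have h1 := gap_ge w gL gs.
have : gap g * enorm w <= gap g * (enorm (u - w) + enorm u) by rewrite ler_wpM2l.
have : gap g * (2 * enorm u) <= gap g * enorm (u - w) by rewrite ler_wpM2l// ltW.
have : gap g' * enorm u <= (gap g + e) * enorm u by rewrite ler_wpM2r.
have : 0 <= e * enorm u by rewrite mulr_ge0.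
nra.
Qed.

Lemma clip_dist L L' g g' e u : lipf L g -> sublin g -> lipf L' g' -> sublin g' ->
  0 <= e -> (forall v, `|g v - g' v| <= e * enorm v) ->
  `|clip g u - clip g' u| <= 9 * e * enorm u.
Proof.
move=> gL gs gL' gs' e0 ge; have H1 := clip_dist_le u gL gs gL' gs' e0 ge.
have H2 : clip g u <= clip g' u + 9 * e * enorm u.
  by apply: clip_dist_le gL' gs' gL gs e0 _ => v; rewrite distrC.
by rewrite ler_norml; apply/andP; split; lra.
Qed.

Definition select h y : 'rV[R]_m := y + steiner (clip (fun u => h u - dotv y u)).

Lemma sublinB_dotv h y : sublin h -> sublin (fun u => h u - dotv y u).
Proof.
move=> [hD hZ]; split=> [u v|s u s0].
  by rewrite dotvDr; have := hD u v; lra.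
by rewrite hZ// dotvZr mulrBr.
Qed.

Lemma lipfB_dotv L h y : lipf L h -> lipf (L + enorm y) (fun u => h u - dotv y u).
Proof.
move=> hL u v; rewrite opprD opprK addrACA [- _ + _]addrC -dotvBr mulrDl.
rewrite (le_trans (ler_normD _ _))// lerD// enormBC; exact: cauchy_schwarz_norm.
Qed.

Lemma select_le L h y w : lipf L h -> sublin h -> dotv (select h y) w <= h w.
Proof.
move=> hL hs; have gs := sublinB_dotv y hs; have gL := lipfB_dotv y hL.
rewrite dotvDl -lerBrDl; apply: le_trans (clip_le_self gL gs w).
exact: steiner_le (clip_sublin gL gs) (clip_lipf gL gs).
Qed.

Lemma select_id L h y : lipf L h -> sublin h -> (forall w, dotv y w <= h w) -> select h y = y.
Proof.
move=> hL hs hy; have gs := sublinB_dotv y hs; have gL := lipfB_dotv y hL.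
rewrite /select; set s := steiner _; suff -> : s = 0 by rewrite addr0.
apply: enorm_eq0; apply/eqP; rewrite -sqrf_eq0 eq_le sqr_ge0 andbT enorm_sqr.
(* The averaged gradient is tested against itself: its squared norm is at most the clipped support
   function, which is 0 because 0 lies in the translated body. *)
rewrite (le_trans (steiner_le _ (clip_sublin gL gs) (clip_lipf gL gs)))//.
by rewrite (clip_eq0 gL gs)// => v; rewrite subr_ge0.
Qed.

(** Translating by the base points turns [e] into [e + enorm (y - y')]. Clipping multiplies by 9 and
    averaging by [m]; the outer base point adds one more, absorbed since [1 <= m]. *)
Lemma select_dist L L' h h' y y' e : (0 < m)%N ->
  lipf L h -> sublin h -> lipf L' h' -> sublin h' -> 0 <= e ->
  (forall u, `|h u - h' u| <= e * enorm u) ->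
  enorm (select h y - select h' y') <= 10 * m%:R * (e + enorm (y - y')).
Proof.
move=> m0 hL hs hL' hs' e0 he.
have gs := sublinB_dotv y hs; have gL := lipfB_dotv y hL.
have gs' := sublinB_dotv y' hs'; have gL' := lipfB_dotv y' hL'.
have ey0 : 0 <= e + enorm (y - y') by rewrite addr_ge0 ?enorm_ge0.
rewrite /select opprD addrACA (le_trans (enormD _ _))//.
have gg u : `|h u - dotv y u - (h' u - dotv y' u)| <= (e + enorm (y - y')) * enorm u.
  rewrite opprD opprK addrACA [- _ + _]addrC -dotvBl mulrDl (le_trans (ler_normD _ _))//.
  rewrite lerD// enormBC; exact: cauchy_schwarz_norm.
have e9 : 0 <= 9 * (e + enorm (y - y')) by rewrite mulr_ge0.
have := steiner_dist (clip_lipf gL gs) (clip_lipf gL' gs') e9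
  (fun u => clip_dist u gL gs gL' gs' ey0 gg).
have m1 : 1 <= m%:R :> R by rewrite ler1n.
have : 1 * (e + enorm (y - y')) <= m%:R * (e + enorm (y - y')) by rewrite ler_wpM2r.
nra.
Qed.

End Selection.

(** * Subgradients *)

Section Subgradient.
Variables (R : realType) (n : nat).
Implicit Types (p q v w : 'rV[R]_n) (phi : 'rV[R]_n -> R) (C : R).

(** For convex [phi] the quotients increase with [s], so the infimum is the one-sided directional
    derivative and no limit is taken. *)
Definition dirderiv phi p w : R :=
  inf [set (phi (p + s *: w) - phi p) / s | s in [set s : R | 0 < s]].

Section Dirderiv.
Variables (C : R) (phi : 'rV[R]_n -> R) (p : 'rV[R]_n).
Hypotheses (cphi : convexf phi) (Lphi : lipf C phi).

Lemma quotient_lbound w (s : R) : 0 < s -> `|(phi (p + s *: w) - phi p) / s| <= C * enorm w.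
Proof.
move=> s0; rewrite normrM [X in _ * X]gtr0_norm ?invr_gt0// ler_pdivrMr//.
rewrite (le_trans (Lphi _ _))// addrAC subrr add0r enormZ gtr0_norm//.
by rewrite mulrCA mulrC.
Qed.

Lemma dirderiv_le w (s : R) : 0 < s -> dirderiv phi p w <= (phi (p + s *: w) - phi p) / s.
Proof.
move=> s0; apply: ge_inf; last by exists s.
exists (- (C * enorm w)) => _ [t /= t0 <-].
by have := quotient_lbound w t0; rewrite ler_norml => /andP[].
Qed.

Lemma dirderiv_ge w (x : R) :
  (forall s : R, 0 < s -> x <= (phi (p + s *: w) - phi p) / s) -> x <= dirderiv phi p w.
Proof.
move=> H; apply: lb_le_inf; last by move=> _ [s s0 <-]; exact: H.
by exists ((phi (p + 1 *: w) - phi p) / 1); exists 1 => //=; exact: ltr01.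
Qed.

Lemma dirderiv_le_lip w : dirderiv phi p w <= C * enorm w.
Proof.
apply: le_trans (dirderiv_le w ltr01) _.
by have := quotient_lbound w ltr01; rewrite ler_norml => /andP[].
Qed.

Lemma dirderiv_sublin : sublin (dirderiv phi p).
Proof.
have ddZ (s : R) w : 0 < s -> dirderiv phi p (s *: w) <= s * dirderiv phi p w.
  move=> s0; rewrite -ler_pdivrMl//; apply: dirderiv_ge => t t0; rewrite ler_pdivrMl//.
  have ts0 : 0 < t / s by rewrite divr_gt0.
  rewrite (le_trans (dirderiv_le _ ts0))// scalerA divfK ?gt_eqF//.
  by rewrite invf_div mulrCA.
split=> [u v|s u].
  rewrite -lerBlDr; apply: dirderiv_ge => s s0; rewrite lerBlDl -lerBlDr.
  apply: dirderiv_ge => t t0; rewrite lerBlDl.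
  have st0 : 0 < s + t by rewrite addr_gt0.
  (* With this step length, the point reached from [p] along [u + v] is a convex combination of
     [p + s *: u] and [p + t *: v]. *)
  have r0 : 0 < s * t / (s + t) by rewrite divr_gt0// mulr_gt0.
  apply: le_trans (dirderiv_le (u + v) r0) _.
  have := cphi (p + s *: u) (p + t *: v) (t := t / (s + t)).
  rewrite divr_ge0 ?(ltW st0) ?(ltW t0)//= ler_pdivrMr// mul1r lerDr (ltW s0) => /(_ isT).
  have -> : 1 - t / (s + t) = s / (s + t) by field; exact: lt0r_neq0.
  rewrite (_ : _ *: _ + _ *: _ = p + (s * t / (s + t)) *: (u + v)); last first.
    rewrite !scalerDr addrACA -scalerDl !scalerA -mulrDl (addrC t s) divff ?lt0r_neq0//.
    by rewrite scale1r; congr (_ + (_ *: _ + _ *: _)); field; exact: lt0r_neq0.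
  move=> H; rewrite ler_pdivrMr//.
  have -> : ((phi (p + s *: u) - phi p) / s + (phi (p + t *: v) - phi p) / t) * (s * t / (s + t)) =
      t / (s + t) * phi (p + s *: u) + s / (s + t) * phi (p + t *: v) - phi p.
    by field; rewrite !lt0r_neq0.
  by rewrite lerD2r.
rewrite le_eqVlt => /predU1P[<-|s0].
  rewrite scale0r mul0r; apply/eqP; rewrite eq_le; apply/andP; split.
    by have := dirderiv_le_lip 0; rewrite enorm0 mulr0.
  by apply: dirderiv_ge => t t0; rewrite scaler0 addr0 subrr mul0r.
apply/eqP; rewrite eq_le ddZ//=; have := ddZ (s^-1) (s *: u).
rewrite invr_gt0 scalerA mulVf ?gt_eqF// scale1r => /(_ s0).
by rewrite ler_pdivlMl.
Qed.

(** Any vector dominated by the directional derivative is a subgradient, and the averaged gradient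
    is such a vector; the quotient at [s = 1] gives the inequality. *)
Lemma subgradient : exists v, forall q, phi p + dotv v (q - p) <= phi q.
Proof.
exists (steiner (dirderiv phi p)) => q.
have := steiner_le (q - p) dirderiv_sublin (sublin_lipf dirderiv_sublin dirderiv_le_lip).
move=> /le_trans/(_ (dirderiv_le _ ltr01)).
by rewrite scale1r subrKC divr1 -lerBrDl.
Qed.

End Dirderiv.
End Subgradient.

(** * Splitting R^(n+1) into a first coordinate and a remainder *)

Section HeadTail.
Variables (R : realType) (n : nat).
Implicit Types (z u : 'rV[R]_n.+1) (p : 'rV[R]_n) (r s : R).

Definition vhead z : R := z ord0 ord0.
Definition vtail z : 'rV[R]_n := \row_i z ord0 (lift ord0 i).
Definition vcons r p : 'rV[R]_n.+1 := \row_i oapp (p ord0) r (unlift ord0 i).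

Lemma vhead_cons r p : vhead (vcons r p) = r.
Proof. by rewrite /vhead mxE unlift_none. Qed.

Lemma vtail_cons r p : vtail (vcons r p) = p.
Proof. by apply/rowP => i; rewrite !mxE liftK. Qed.

Lemma vcons_eta z : vcons (vhead z) (vtail z) = z.
Proof.
by apply/rowP => i; rewrite mxE; case: unliftP => [j|] ->; rewrite //= mxE.
Qed.

Lemma vheadB z u : vhead (z - u) = vhead z - vhead u.
Proof. by rewrite /vhead !mxE. Qed.

Lemma vtailB z u : vtail (z - u) = vtail z - vtail u.
Proof. by apply/rowP => i; rewrite !mxE. Qed.

Lemma vconsZ s r p : s *: vcons r p = vcons (s * r) (s *: p).
Proof.
by apply/rowP => i; rewrite !mxE; case: (unliftP ord0 i) => [j|] _; rewrite //= ?mxE.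
Qed.

Lemma vconsB r s p q : vcons r p - vcons s q = vcons (r - s) (p - q).
Proof.
by apply/rowP => i; rewrite !mxE; case: (unliftP ord0 i) => [j|] _; rewrite //= ?mxE.
Qed.

Lemma dotv_head_tail z u : dotv z u = vhead z * vhead u + dotv (vtail z) (vtail u).
Proof.
by rewrite /dotv big_ord_recl; congr (_ + _); apply: eq_bigr => i _; rewrite !mxE.
Qed.

Lemma normr_vhead z : `|vhead z| <= enorm z.
Proof. exact: coord_le_enorm. Qed.

Lemma enorm_vtail z : enorm (vtail z) <= enorm z.
Proof.
rewrite -(ler_pXn2r (ltn0Sn 1)) ?nnegrE ?enorm_ge0// !enorm_sqr (dotv_head_tail z).
by rewrite lerDr -expr2 sqr_ge0.
Qed.

Lemma enorm_head_tail z : enorm z <= `|vhead z| + enorm (vtail z).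
Proof.
rewrite -(ler_pXn2r (ltn0Sn 1)) ?nnegrE ?addr_ge0 ?enorm_ge0// enorm_sqr.
rewrite dotv_head_tail sqrrD enorm_sqr real_normK ?num_real// -expr2.
by rewrite -addrA lerD2l lerDr mulrn_wge0// mulr_ge0// enorm_ge0.
Qed.

End HeadTail.

(** * Truncated epigraph of the conjugate *)

Section Support.
Variables (R : realType) (n : nat).
Implicit Types (z u : 'rV[R]_n.+1) (p q v : 'rV[R]_n) (phi : 'rV[R]_n -> R) (C lam : R).

(* For phi = H(t,x,.) and lam = lambda(t,x) this is the set E of the header, with
   the last coordinate r of the text stored first. *)
Definition lowepi phi lam : set 'rV[R]_n.+1 :=
  [set z | (forall p, dotv (vtail z) p - phi p <= vhead z) /\ vhead z <= lam].

Definition supp phi lam u : R := sup [set dotv z u | z in lowepi phi lam].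

(** On E the head lies between [- phi 0] and [lam], and the tail has norm at most [C]. *)
Definition radius C phi lam : R := Num.max `|lam| `|phi 0| + C.

(** The last clause says that the conjugate is at most [lam] on its domain, with finiteness
    expressed by a real bound [r]. *)
Definition admissible C phi lam :=
  [/\ convexf phi, 0 <= C, lipf C phi &
      forall v (r : R), (forall p, dotv v p - phi p <= r) -> forall p, dotv v p - phi p <= lam].

Section Admissible.
Variables (C lam : R) (phi : 'rV[R]_n -> R).
Hypothesis adm : admissible C phi lam.

Let C0 : 0 <= C. Proof. by case: adm. Qed.
Let Lphi : lipf C phi. Proof. by case: adm. Qed.

Lemma enorm_dom v (r : R) : (forall p, dotv v p - phi p <= r) -> enorm v <= C.
Proof.
move=> vr; rewrite leNgt; apply/negP => Cv.
have v0 : 0 < enorm v by exact: le_lt_trans Cv.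
have d0 : 0 < enorm v * (enorm v - C) by rewrite mulr_gt0// subr_gt0.
(* Along the ray through [v] the expression grows at rate at least [enorm v * (enorm v - C)]; at
   this [s] it exceeds [r]. *)
set s := (`|r + phi 0| + 1) / (enorm v * (enorm v - C)).
have s0 : 0 < s by rewrite divr_gt0// ltr_wpDl.
have := vr (s *: v); rewrite dotvZr -enorm_sqr.
have := Lphi (s *: v) 0; rewrite subr0 enormZ (gtr0_norm s0) ler_norml => /andP[_ H1] H2.
have : s * (enorm v * (enorm v - C)) = `|r + phi 0| + 1 by rewrite /s divfK ?gt_eqF.
have := ler_norm (r + phi 0); nra.
Qed.

(** A subgradient [v] at [p] attains the conjugate there, so its graph point has head
    [dotv v p - phi p]; admissibility keeps that below [lam]. *)
Lemma subgradient_lowepi p : exists v,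
  lowepi phi lam (vcons (dotv v p - phi p) v).
Proof.
case: adm => cphi _ _ hlam; have [v vp] := subgradient p cphi Lphi.
have H q : dotv v q - phi q <= dotv v p - phi p.
  by have := vp q; rewrite dotvBr; lra.
by exists v; split; rewrite ?vhead_cons ?vtail_cons//; exact: hlam H p.
Qed.

Lemma lowepi_nonempty : lowepi phi lam !=set0.
Proof. by have [v ?] := subgradient_lowepi 0; eexists; eassumption. Qed.

Lemma enorm_epi z : lowepi phi lam z -> enorm z <= radius C phi lam.
Proof.
case=> z1 z2; rewrite (le_trans (enorm_head_tail _))// /radius lerD//; last exact: enorm_dom z1.
have := z1 0; rewrite dotv0r sub0r => z0.
have := ler_norm lam; have := ler_norm (phi 0); have := ler_norm (- phi 0); rewrite normrN.
move=> h1 h2 h3; rewrite le_max !ler_norml; apply/orP.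
have [h|h] := leP 0 (vhead z); [left|right]; apply/andP; split; lra.
Qed.

Lemma supp_ub z u : lowepi phi lam z -> dotv z u <= supp phi lam u.
Proof.
move=> zE; apply: ub_le_sup; last by exists z.
exists (radius C phi lam * enorm u) => _ [y yE <-].
rewrite (le_trans (cauchy_schwarz _ _))// ler_wpM2r ?enorm_ge0//; exact: enorm_epi.
Qed.

Lemma supp_le u (x : R) : (forall z, lowepi phi lam z -> dotv z u <= x) -> supp phi lam u <= x.
Proof.
move=> H; apply: ge_sup; last by move=> _ [z zE <-]; exact: H.
by have [z zE] := lowepi_nonempty; exists (dotv z u); exists z.
Qed.

Lemma supp_sublin : sublin (supp phi lam).
Proof.
split=> [u v|s u].
  by apply: supp_le => z zE; rewrite dotvDr lerD// supp_ub.
have suppZ (t : R) w : 0 <= t -> supp phi lam (t *: w) <= t * supp phi lam w.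
  by move=> t0; apply: supp_le => z zE; rewrite dotvZr ler_wpM2l// supp_ub.
rewrite le_eqVlt => /predU1P[<-|s0].
  rewrite scale0r mul0r; apply/eqP; rewrite eq_le; apply/andP; split.
    by apply: supp_le => z _; rewrite dotv0r.
  by have [z zE] := lowepi_nonempty; have := supp_ub 0 zE; rewrite dotv0r.
apply/eqP; rewrite eq_le (suppZ _ _ (ltW s0))/=; have := suppZ (s^-1) (s *: u).
rewrite invr_ge0 scalerA mulVf ?gt_eqF// scale1r => /(_ (ltW s0)).
by rewrite ler_pdivlMl.
Qed.

Lemma supp_lipf : lipf (radius C phi lam) (supp phi lam).
Proof.
apply: sublin_lipf supp_sublin _ => u; apply: supp_le => z zE.
rewrite (le_trans (cauchy_schwarz _ _))// ler_wpM2r ?enorm_ge0//; exact: enorm_epi.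
Qed.

(** Biconjugation: one inequality is the definition of the epigraph, the other comes from the
    subgradient at [p]. *)
Lemma supp_graph p : supp phi lam (vcons (-1) p) = phi p.
Proof.
apply/eqP; rewrite eq_le; apply/andP; split.
  apply: supp_le => z [z1 _]; rewrite dotv_head_tail vhead_cons vtail_cons.
  have := z1 p; lra.
have [v vE] := subgradient_lowepi p; have := supp_ub (vcons (-1) p) vE.
by rewrite dotv_head_tail !vhead_cons !vtail_cons; lra.
Qed.

Lemma supp_neg (s : R) p : 0 < s -> supp phi lam (vcons (- s) p) = s * phi (s^-1 *: p).
Proof.
move=> s0; rewrite -supp_graph -supp_sublin.2 ?(ltW s0)// vconsZ scalerA divff ?gt_eqF//.
by rewrite scale1r mulrN1.
Qed.

(** Raising the head of a point of E to [lam] stays in E, so for [r >= 0] only points with head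
    [lam] matter. *)
Lemma supp_pos (r : R) p : 0 <= r ->
  supp phi lam (vcons r p) = supp phi lam (vcons 0 p) + lam * r.
Proof.
move=> r0; apply/eqP; rewrite eq_le; apply/andP; split.
  apply: supp_le => z zE; have := supp_ub (vcons 0 p) zE.
  rewrite !dotv_head_tail !vhead_cons !vtail_cons.
  have : vhead z * r <= lam * r by rewrite ler_wpM2r//; case: zE.
  lra.
rewrite -lerBrDr; apply: supp_le => z [z1 z2]; rewrite lerBrDr.
have zE : lowepi phi lam (vcons lam (vtail z)).
  split; rewrite vhead_cons ?vtail_cons// => q; exact: le_trans (z1 q) z2.
have := supp_ub (vcons r p) zE.
rewrite !dotv_head_tail !vhead_cons !vtail_cons; lra.
Qed.

Lemma supp_zero_approx (s : R) p : 0 <= s ->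
  `|supp phi lam (vcons 0 p) - supp phi lam (vcons (- s) p)| <= radius C phi lam * s.
Proof.
move=> s0; apply: le_trans (supp_lipf _ _) _.
rewrite vconsB subrr sub0r opprK; apply: ler_wpM2l.
  by rewrite addr_ge0// le_max normr_ge0.
by rewrite (le_trans (enorm_head_tail _))// vhead_cons vtail_cons enorm0 addr0 ger0_norm.
Qed.

Lemma le_supp_tail y : (forall u, dotv y u <= supp phi lam u) ->
  forall p, dotv (vtail y) p - phi p <= vhead y.
Proof.
move=> yu p; have := yu (vcons (-1) p).
by rewrite supp_graph dotv_head_tail vhead_cons vtail_cons; lra.
Qed.

End Admissible.

(* On vhead u = 0 there is no formula for the support function: the bound there
   is the limit of the bounds at vhead u = - s < 0. *)
Lemma supp_dist_le C C' phi phi' lam lam' (kap : R) u : admissible C phi lam ->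
  admissible C' phi' lam' -> 0 <= kap ->
  (forall p, `|phi p - phi' p| <= kap * (1 + enorm p)) -> `|lam - lam'| <= kap ->
  supp phi lam u <= supp phi' lam' u + 2 * kap * enorm u.
Proof.
move=> A A' k0 phik lamk.
have neg (s : R) p : 0 < s -> supp phi lam (vcons (- s) p) <=
    supp phi' lam' (vcons (- s) p) + kap * (s + enorm p).
  move=> s0; rewrite (supp_neg A)// (supp_neg A')//.
  have := phik (s^-1 *: p); rewrite ler_norml => /andP[_].
  rewrite enormZ gtr0_norm ?invr_gt0// -(ler_pM2l s0) => H.
  have E : s * (kap * (1 + s^-1 * enorm p)) = kap * (s + enorm p).
    by field; exact: lt0r_neq0.
  by move: H; rewrite E mulrBr lerBlDl.
have zero p : supp phi lam (vcons 0 p) <= supp phi' lam' (vcons 0 p) + kap * enorm p.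
  apply/ler_addgt0Pr => e e0.
  have r0 : 0 <= radius C phi lam.
    by rewrite addr_ge0 ?le_max ?normr_ge0//; case: A.
  have r0' : 0 <= radius C' phi' lam'.
    by rewrite addr_ge0 ?le_max ?normr_ge0//; case: A'.
  (* With [s = e / M], the two passages from head 0 to head [- s] and the term [kap * s] together
     cost at most [e]. *)
  set M := radius C phi lam + radius C' phi' lam' + kap + 1.
  have M0 : 0 < M by rewrite /M; lra.
  have s0 : 0 < e / M by rewrite divr_gt0.
  have := supp_zero_approx A p (ltW s0); rewrite ler_norml => /andP[_].
  have := supp_zero_approx A' p (ltW s0); rewrite ler_norml => /andP[+ _].
  have := neg _ p s0; have : e / M * M = e by rewrite divfK ?gt_eqF.
  rewrite /M; nra.
have uh := normr_vhead u; have ut := enorm_vtail u.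
have kh : kap * `|vhead u| <= kap * enorm u by rewrite ler_wpM2l.
have kt : kap * enorm (vtail u) <= kap * enorm u by rewrite ler_wpM2l.
have [u0|u0] := ltP (vhead u) 0.
  have := neg (- vhead u) (vtail u); rewrite opprK vcons_eta oppr_gt0 => /(_ u0).
  by move: kh; rewrite ltr0_norm//; lra.
have := supp_pos A (vtail u) u0; have := supp_pos A' (vtail u) u0; rewrite vcons_eta => -> ->.
have := zero (vtail u); move: kh; rewrite ger0_norm// => kh.
have : (lam - lam') * vhead u <= kap * vhead u.
  by rewrite ler_wpM2r// (le_trans (ler_norm _)).
lra.
Qed.

Lemma supp_dist C C' phi phi' lam lam' (kap : R) u : admissible C phi lam ->
  admissible C' phi' lam' -> 0 <= kap ->
  (forall p, `|phi p - phi' p| <= kap * (1 + enorm p)) -> `|lam - lam'| <= kap ->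
  `|supp phi lam u - supp phi' lam' u| <= 2 * kap * enorm u.
Proof.
move=> A A' k0 phik lamk; have H1 := supp_dist_le u A A' k0 phik lamk.
have H2 : supp phi' lam' u <= supp phi lam u + 2 * kap * enorm u.
  by apply: supp_dist_le A' A k0 _ _ => [p|]; rewrite distrC.
by rewrite ler_norml; apply/andP; split; lra.
Qed.

End Support.

(** * The conjugate with extended real values *)

Section Fenchel.
Variables (R : realType) (n : nat).
Implicit Types (phi : 'rV[R]_n -> R) (v p : 'rV[R]_n) (r : R).

Lemma fenchel_leP phi v r :
  (fenchel phi v <= r%:E)%E <-> (forall p, dotv v p - phi p <= r).
Proof.
split=> [vr p|vr]; last first.
  by apply: ge_ereal_sup => _ [p _ <-]; rewrite lee_fin.
by rewrite -lee_fin; apply: le_trans vr; apply: ereal_sup_ubound; exists p.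
Qed.

Lemma edom_fenchelP phi v :
  edom (fenchel phi) v <-> exists r, fenchel phi v = r%:E.
Proof.
split=> [[v1 v2]|[r]]; last by rewrite /edom /= => ->.
by case: (fenchel phi v) v1 v2 => // r _ _; exists r.
Qed.

Lemma edom_fenchel_bounded phi v r :
  (forall p, dotv v p - phi p <= r) -> edom (fenchel phi) v.
Proof.
move=> /fenchel_leP vr; split=> v1; move: vr; first by rewrite v1.
move=> _; have : ((dotv v 0 - phi 0)%:E <= fenchel phi v)%E.
  by apply: ereal_sup_ubound; exists 0.
by rewrite v1.
Qed.

Lemma admissible_fenchel C phi (lam : R) : 0 <= C -> convex_function setT phi ->
  (forall p q, `|phi p - phi q| <= C * enorm (p - q)) ->
  (forall v, edom (fenchel phi) v -> (fenchel phi v <= lam%:E)%E) ->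
  admissible C phi lam.
Proof.
move=> C0 cphi Lphi hlam; split=> // [u v t /andP[t0 t1]|v r vr].
  have i01 : Itv.spec (@Itv.num_sem R) (Itv.Real `[0%Z, 1%Z]) t.
    by rewrite /Itv.num_sem/= in_itv/= num_real t0 t1.
  by have := cphi (Itv.mk i01) u v (mem_set I) (mem_set I).
by apply/fenchel_leP/hlam; exact: edom_fenchel_bounded vr.
Qed.

End Fenchel.

(** * Parametrization of the truncated epigraph by the unit ball *)

Section Parametrization.
Variables (R : realType) (n : nat).
Implicit Types (phi : 'rV[R]_n -> R) (a : 'rV[R]_n.+1) (v p : 'rV[R]_n) (C lam : R).

Definition param C phi lam a : 'rV[R]_n.+1 :=
  select (supp phi lam) (radius C phi lam *: a).

Lemma param_dist C C' phi phi' lam lam' a a' (e : R) :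
  admissible C phi lam -> admissible C' phi' lam' -> 0 <= e ->
  (forall u, `|supp phi lam u - supp phi' lam' u| <= e * enorm u) ->
  enorm (param C phi lam a - param C' phi' lam' a') <=
    10 * (n%:R + 1) * (e + enorm (radius C phi lam *: a - radius C' phi' lam' *: a')).
Proof.
move=> A A' e0 he; rewrite natr1.
exact: select_dist (supp_lipf A) (supp_sublin A) (supp_lipf A') (supp_sublin A') e0 he.
Qed.

Section Admissible.
Variables (C lam : R) (phi : 'rV[R]_n -> R).
Hypothesis adm : admissible C phi lam.

Lemma param_epi a p :
  dotv (vtail (param C phi lam a)) p - phi p <= vhead (param C phi lam a).
Proof.
apply: (le_supp_tail adm) => u.
exact: select_le (supp_lipf adm) (supp_sublin adm).
Qed.

Lemma param_onto z : lowepi phi lam z -> exists2 a, eball 1 a & param C phi lam a = z.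
Proof.
move=> zE; have zr := enorm_epi adm zE; set r := radius _ _ _ in zr.
have az : r *: (r^-1 *: z) = z.
  (* A zero radius forces [z = 0], so the equation holds there too. *)
  have [r0|r0] := eqVneq r 0; last by rewrite scalerA divff ?scale1r.
  rewrite r0 scale0r; apply/esym/enorm_eq0/eqP.
  by rewrite eq_le enorm_ge0 -r0 zr.
exists (r^-1 *: z).
  rewrite /eball/= enormZ; have r0 : 0 <= r by rewrite (le_trans _ zr)// enorm_ge0.
  rewrite ger0_norm ?invr_ge0//.
  have [->|rn] := eqVneq r 0; first by rewrite invr0 mul0r ler01.
  by rewrite ler_pdivrMl ?mulr1// lt_def rn.
rewrite /param -/r az; apply: select_id (supp_lipf adm) (supp_sublin adm) _ => w.
exact: (supp_ub adm w zE).
Qed.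

Lemma param_graph v (r : R) : fenchel phi v = r%:E ->
  exists2 a, eball 1 a & param C phi lam a = vcons r v.
Proof.
move=> vr; have /fenchel_leP vr' : (fenchel phi v <= r%:E)%E by rewrite vr.
apply: param_onto; split; rewrite ?vhead_cons ?vtail_cons//.
case: adm => _ _ _ /(_ _ _ vr')/fenchel_leP.
by rewrite vr lee_fin.
Qed.

(** Every value of [param] lies in the epigraph of the conjugate, which bounds the supremum; the
    graph point of a subgradient at [p] attains it. *)
Lemma param_sup p : (phi p)%:E =
  ereal_sup [set (dotv p (vtail (param C phi lam a)) - vhead (param C phi lam a))%:E
             | a in @eball R n.+1 1].
Proof.
apply/eqP; rewrite eq_le; apply/andP; split; last first.
  apply: ge_ereal_sup => _ [a _ <-]; rewrite lee_fin.
  by have := param_epi a p; rewrite dotvC; lra.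
have [v /param_onto[a a1 av]] := subgradient_lowepi adm p.
apply: ereal_sup_ubound; exists a => //.
by rewrite av vhead_cons vtail_cons dotvC opprB addrCA subrr addr0.
Qed.

Lemma param_dom :
  (fun a => vtail (param C phi lam a)) @` eball 1 = edom (fenchel phi).
Proof.
apply/seteqP; split=> [_ [a _ <-]|v /edom_fenchelP[r vr]].
  exact: edom_fenchel_bounded (param_epi a).
have [a a1 av] := param_graph vr; exists a => //.
by rewrite av vtail_cons.
Qed.

Lemma enorm_param a : enorm (vtail (param C phi lam a)) <= C.
Proof. by apply: (enorm_dom adm) => p; exact: param_epi. Qed.

End Admissible.
End Parametrization.

(** * Measurability *)

Section RationalPoints.
Variables (R : realType) (m : nat).
Implicit Types (u : 'rV[R]_m) (q : 'rV[rat]_m).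

Definition ratrv q : 'rV[R]_m := map_mx ratr q.

Lemma ratrv_dense u (e : R) : 0 < e -> exists q, enorm (u - ratrv q) < e.
Proof.
(* Dividing by [m + 1] covers [m = 0] and makes the sum of the coordinate errors strictly less than
   [e]. *)
move=> e0; have e1 : 0 < e / (m%:R + 1) by rewrite divr_gt0// ltr_wpDl.
have /choice[q qP] i : exists x : rat, `|u ord0 i - ratr x| <= e / (m%:R + 1).
  have /rat_in_itvoo[x] : u ord0 i - e / (m%:R + 1) < u ord0 i + e / (m%:R + 1) by lra.
  by rewrite in_itv/= => /andP[? ?]; exists x; rewrite ler_norml; apply/andP; split; lra.
exists (\row_i q i); apply: le_lt_trans (enorm_le_sum _) _.
apply: (@le_lt_trans _ _ (\sum_(i < m) e / (m%:R + 1))).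
  by apply: ler_sum => i _; rewrite !mxE; exact: qP.
rewrite sumr_const card_ord -(mulr_natl (e / _)) mulrCA gtr_pMr// ltr_pdivrMr ?mul1r ?ltrDl//.
Qed.

Lemma lipf_ratrv_lt (L : R) F u (r : R) : lipf L F -> F u < r -> exists q, F (ratrv q) < r.
Proof.
move=> FL Fr; have d0 : 0 < (r - F u) / (`|L| + 1).
  by rewrite divr_gt0 ?subr_gt0// ltr_wpDl.
have [q qu] := ratrv_dense u d0; exists q.
have := FL u (ratrv q); rewrite ler_norml => /andP[+ _].
have h0 := enorm_ge0 (u - ratrv q).
have : L * enorm (u - ratrv q) <= `|L| * enorm (u - ratrv q) by rewrite ler_wpM2r// ler_norm.
have : (`|L| + 1) * enorm (u - ratrv q) < r - F u.
  by rewrite mulrC -ltr_pdivlMr// ltr_wpDl.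
lra.
Qed.

End RationalPoints.

Section Measurability.
Context d (T : measurableType d) (R : realType).
Implicit Types (D : set T) (f : T -> R).

Lemma measurable_lt D f (x : R) : measurable D -> measurable_fun D f ->
  measurable (D `&` [set t | f t < x]).
Proof.
move=> mD mf; have := mf mD `]-oo, x[%classic (measurable_itv _).
by congr measurable; apply/seteqP; split=> t /=; rewrite in_itv.
Qed.

(** The hypothesis says that [f] is the infimum of the countable family, in terms of strict sublevel
    sets, which are then countable unions. *)
Lemma measurable_fun_countable_inf (I : countType) D (F : I -> T -> R) f :
  (forall i, measurable_fun D (F i)) ->
  (forall t x, D t -> f t < x <-> exists i, F i t < x) -> measurable_fun D f.
Proof.
move=> mF fF mD; apply: (measurability _ (RGenInftyO.measurableE R)) => //.
move=> /= _ [_ [x ->] <-].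
rewrite [X in measurable X](_ : _ = \bigcup_i (D `&` [set t | F i t < x])).
  by apply: countable_bigcupT_measurable => // i; exact: measurable_lt.
apply/seteqP; split=> [t [Dt]|t [i _ [Dt Fi]]]/=.
  by rewrite in_itv/= => /(fF _ _ Dt)[i Fi]; exists i.
by split=> //; rewrite in_itv/=; apply/(fF _ _ Dt); exists i.
Qed.

(** An open set is the countable union of the rational Euclidean balls inside it. Squared norms make
    the preimage of a ball a sublevel set of a polynomial in the coordinates. *)
Lemma measurable_fun_rV (m : nat) D (g : T -> 'rV[R]_m) :
  (forall i, measurable_fun D (fun t => g t ord0 i)) ->
  @measurable_fun _ _ T (borel_rV R m) D g.
Proof.
move=> mg mD; apply: (@measurability _ _ _ (borel_rV R m) D g (@open 'rV[R]_m) erefl) => // _ [U oU <-].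
pose N (z : 'rV[rat]_m * rat) := [set u : 'rV[R]_m | enorm (u - ratrv R z.1) ^+ 2 < ratr z.2 ^+ 2].
pose J := {z : 'rV[rat]_m * rat | `[< N z `<=` U >]}.
rewrite [X in measurable X](_ : _ = \bigcup_(z : J) (D `&` g @^-1` (N (val z)))).
  apply: countable_bigcupT_measurable => [|z]; first exact: (@countableP J).
  apply: measurable_lt => //.
  under eq_fun do rewrite enorm_sqr /dotv.
  apply: measurable_sum => i; apply: measurable_funM;
  by under eq_fun do rewrite !mxE; apply: measurable_funB.
apply/seteqP; split=> [t [Dt /= Ugt]|t [z _ [Dt Nz]]]; last first.
  by split=> //; apply: (asboolP _ (valP z)).
have /nbhs_ballP[e /= e0 eU] : nbhs (g t) U by apply: open_nbhs_nbhs.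
have /rat_in_itvoo[x] : 0 < e / 2 by rewrite divr_gt0.
rewrite in_itv/= => /andP[x0 xe].
have [q qg] := ratrv_dense (g t) x0.
have NU : N (q, x) `<=` U.
  move=> u; rewrite /N/= ltr_pXn2r ?nnegrE ?enorm_ge0 ?(ltW x0)// => uq.
  apply: eU; split=> // i j; rewrite /ball/= (ord1 i).
  have := coord_le_enorm (g t - u) j; rewrite !mxE => /le_lt_trans; apply.
  apply: le_lt_trans (enormB_triangle (ratrv R q) _ _) _.
  by rewrite (enormBC _ u); lra.
have Nq : `[< N (q, x) `<=` U >] by apply/asboolP.
exists (exist _ (q, x) Nq) => //; split=> //.
by rewrite /N/= ltr_pXn2r ?nnegrE ?enorm_ge0 ?(ltW x0).
Qed.

Section Family.
Variables (m : nat) (D : set T) (h : T -> 'rV[R]_m -> R) (L : T -> R).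
Hypothesis mh : forall u, measurable_fun D (fun t => h t u).
Hypothesis hL : forall t, D t -> lipf (L t) (h t).

Lemma measurable_davgs N i s u : measurable_fun D (fun t => davgs N i s (h t) u).
Proof.
elim: s u => [|k s IH] u /=; first exact: mh.
rewrite /dop; case: ifP => _.
  by apply: measurable_funM => //; apply: measurable_funB; exact: IH.
by apply: measurable_funM => //; apply: measurable_sum => j; exact: IH.
Qed.

Lemma measurable_steiner i : measurable_fun D (fun t => steiner (h t) ord0 i).
Proof.
apply: (@measurable_fun_cvg _ _ _ _
  (fun J t => davgs (2 ^ J) i (index_enum 'I_m) (h t) 0)) => [J|t Dt].
  exact: measurable_davgs.
by rewrite mxE; exact: cvgn_steiner (hL Dt).
Qed.

Hypothesis hs : forall t, D t -> sublin (h t).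

(** Radial projection to the unit ball, giving a countable dense subset of it. *)
Let unitize (q : 'rV[rat]_m) : 'rV[R]_m :=
  (Num.max 1 (enorm (ratrv R q)))^-1 *: ratrv R q.

Let max_gt0 (x : R) : 0 < Num.max 1 x. Proof. by rewrite lt_max ltr01. Qed.

Lemma measurable_gap : measurable_fun D (fun t => gap (h t)).
Proof.
under eq_fun do rewrite -[gap _]opprK; apply: measurable_funN.
apply: (@measurable_fun_countable_inf _ _ (fun q t => h t (unitize q))) => [q|t x Dt].
  exact: mh.
split=> [|[q hq]]; last first.
  apply: le_lt_trans hq; rewrite lerNl; apply: gap_ub (hL Dt) (hs Dt) _.
  rewrite enormZ gtr0_norm ?invr_gt0// ler_pdivrMl// mulr1 le_max lexx orbT//.
rewrite ltrNl => /sup_gt[|_ [u u1 <-]].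
  by exists (- h t 0); exists 0 => //; rewrite /eball/= enorm0.
rewrite ltrN2 => hu.
(* The 2 pays for approximating [u] by [v] and for pulling [v], of norm at most [1 + e], back into
   the ball. *)
have d0 : 0 < (x - h t u) / (2 * (`|L t| + 1)).
  by rewrite divr_gt0 ?subr_gt0// mulr_gt0// ltr_wpDl.
have [q qu] := ratrv_dense u d0; exists q; move: qu.
set e := _ / _ in d0 *; set v := ratrv R q => qu.
have v1 : enorm v <= 1 + e.
  by have := enormB_triangle u v 0; rewrite !subr0 enormBC; move: u1 qu; rewrite /eball/=; lra.
have M1 : 1 <= Num.max 1 (enorm v) by rewrite le_max lexx.
have M2 : Num.max 1 (enorm v) <= 1 + e by rewrite ge_max v1 andbT; lra.
have uv : enorm (u - unitize q) <= 2 * e.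
  apply: le_trans (enormB_triangle v _ _) _.
  have -> : v - unitize q = ((Num.max 1 (enorm v) - 1) / Num.max 1 (enorm v)) *: v.
    rewrite mulrBl mul1r divff ?scalerBl ?scale1r// gt_eqF//.
  rewrite enormZ ger0_norm; last by rewrite divr_ge0 ?subr_ge0// ltW.
  have : (Num.max 1 (enorm v) - 1) / Num.max 1 (enorm v) * enorm v <= Num.max 1 (enorm v) - 1.
    rewrite -mulrA ler_piMr ?subr_ge0// ler_pdivrMl// mulr1 le_max lexx orbT//.
  lra.
have := hL Dt u (unitize q); rewrite ler_norml => /andP[+ _].
have h0 := enorm_ge0 (u - unitize q).
have : L t * enorm (u - unitize q) <= `|L t| * enorm (u - unitize q).
  by rewrite ler_wpM2r// ler_norm.
have : `|L t| * enorm (u - unitize q) <= `|L t| * (2 * e) by rewrite ler_wpM2l.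
have : (2 * (`|L t| + 1)) * e = x - h t u.
  by rewrite /e mulrC divfK// gt_eqF// mulr_gt0// ltr_wpDl.
lra.
Qed.

(** The expression minimized in [clip] is Lipschitz in [w], so rational [w] suffice. *)
Lemma measurable_clip u : measurable_fun D (fun t => clip (h t) u).
Proof.
apply: (@measurable_fun_countable_inf _ _
  (fun q t => h t (ratrv R q) + 3 * gap (h t) * enorm (u - ratrv R q))) => [q|t x Dt].
  apply: measurable_funD; first exact: mh.
  by apply: measurable_funM => //; apply: measurable_funM => //; exact: measurable_gap.
split=> [|[q hq]]; last exact: le_lt_trans (clip_le (hL Dt) (hs Dt) _ _) hq.
move=> /inf_lt[|_ [w _ <-]].
  by exists (h t 0 + 3 * gap (h t) * enorm (u - 0)); exists 0.
apply: (@lipf_ratrv_lt _ _ (L t + 3 * gap (h t))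
  (fun w => h t w + 3 * gap (h t) * enorm (u - w))) => v v'.
rewrite opprD addrACA -mulrBr [leRHS]mulrDl (le_trans (ler_normD _ _))// lerD ?hL//.
have d0 := gap_ge0 (hL Dt) (hs Dt).
rewrite normrM ger0_norm ?mulr_ge0// ler_wpM2l ?mulr_ge0// ler_norml.
have := enormB_triangle v' u v; have := enormB_triangle v u v'.
by rewrite (enormBC v' v) => ? ?; apply/andP; split; lra.
Qed.

End Family.

Lemma measurable_select (m : nat) D (h : T -> 'rV[R]_m -> R) (L : T -> R) (y : T -> 'rV[R]_m) i :
  (forall u, measurable_fun D (fun t => h t u)) ->
  (forall j, measurable_fun D (fun t => y t ord0 j)) ->
  (forall t, D t -> lipf (L t) (h t)) -> (forall t, D t -> sublin (h t)) ->
  measurable_fun D (fun t => select (h t) (y t) ord0 i).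
Proof.
move=> mh my hL hs; under eq_fun do rewrite mxE; apply: measurable_funD => //.
pose g t u := h t u - dotv (y t) u.
have gs t : D t -> sublin (g t) by move=> Dt; exact: sublinB_dotv (hs _ Dt).
have gL t : D t -> lipf (L t + enorm (y t)) (g t) by move=> Dt; exact: lipfB_dotv (hL _ Dt).
have mg u : measurable_fun D (fun t => g t u).
  apply: measurable_funB => //; apply: measurable_sum => j.
  exact: measurable_funM.
apply: (@measurable_steiner _ _ (fun t => clip (g t)) (fun t => 3 * gap (g t))) => [u|t Dt].
  exact: measurable_clip mg gL gs u.
exact: clip_lipf (gL _ Dt) (gs _ Dt).
Qed.

Section Param.
Variables (n : nat) (D : set T) (C lam : T -> R) (phi : T -> 'rV[R]_n -> R).
Hypothesis mC : measurable_fun D C.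
Hypothesis mlam : measurable_fun D lam.
Hypothesis mphi : forall p, measurable_fun D (fun t => phi t p).
Hypothesis adm : forall t, D t -> admissible (C t) (phi t) (lam t).

(** By the sign of the head: negative heads reduce to [phi], head 0 is a limit of negative ones, and
    positive heads add a multiple of [lam]. *)
Lemma measurable_supp u : measurable_fun D (fun t => supp (phi t) (lam t) u).
Proof.
have neg (s : R) p : 0 < s -> measurable_fun D (fun t => supp (phi t) (lam t) (vcons (- s) p)).
  move=> s0; apply: (@eq_measurable_fun _ _ _ _ _ (fun t => s * phi t (s^-1 *: p))).
    by move=> t; rewrite inE => Dt; rewrite (supp_neg (adm Dt)).
  exact: measurable_funM.
have zero p : measurable_fun D (fun t => supp (phi t) (lam t) (vcons 0 p)).
  apply: (@measurable_fun_cvg _ _ _ _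
    (fun J t => supp (phi t) (lam t) (vcons (- J.+1%:R^-1) p))) => [J|t Dt].
    by apply: neg; rewrite invr_gt0.
  have cr : radius (C t) (phi t) (lam t) * J.+1%:R^-1 @[J --> \oo] --> (0 : R).
    rewrite -(mulr0 (radius (C t) (phi t) (lam t))); apply: cvgMr; exact: cvg_harmonic.
  apply/cvgrPdist_le => e e0; move/cvgrPdist_le: cr => /(_ e e0); apply: filterS => J.
  rewrite sub0r normrN; apply: le_trans.
  apply: le_trans (supp_zero_approx (adm Dt) p _) (ler_norm _).
  by rewrite invr_ge0.
have [u0|u0] := ltP (vhead u) 0.
  rewrite -(vcons_eta u) -[vhead u]opprK; apply: neg; lra.
apply: (@eq_measurable_fun _ _ _ _ _ (fun t =>
    supp (phi t) (lam t) (vcons 0 (vtail u)) + lam t * vhead u)).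
  by move=> t; rewrite inE => Dt; rewrite -(supp_pos (adm Dt))// vcons_eta.
by apply: measurable_funD => //; exact: measurable_funM.
Qed.

Lemma measurable_param a i :
  measurable_fun D (fun t => param (C t) (phi t) (lam t) a ord0 i).
Proof.
apply: (@measurable_select _ _ _ (fun t => radius (C t) (phi t) (lam t))).
- exact: measurable_supp.
- move=> j; under eq_fun do rewrite mxE; apply: measurable_funM => //.
  apply: measurable_funD => //; apply: measurable_maxr; exact: measurableT_comp.
- by move=> t Dt; exact: supp_lipf (adm Dt).
- by move=> t Dt; exact: supp_sublin (adm Dt).
Qed.

End Param.
End Measurability.

(** * Continuity *)

Section EuclideanTopology.
Variables (R : realType) (m : nat).

Lemma enorm_continuous : continuous (@enorm R m).
Proof.
rewrite (_ : @enorm R m = Num.sqrt \o (fun u => dotv u u))// => u.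
apply: continuous_comp; last exact: sqrt_continuous.
apply: continuous_big => [|i _ v]; first exact: add_continuous.
by have cv := @coord_continuous R 1 m ord0 i v; exact: (continuousM cv cv).
Qed.

Lemma cvg_enormB (Z : Type) (F : set_system Z) {FF : Filter F}
    (g : Z -> 'rV[R]_m) (l : 'rV[R]_m) (e : R) :
  g @ F --> l -> 0 < e -> \forall z \near F, enorm (g z - l) < e.
Proof.
move=> gl e0; have : enorm (g z - l) @[z --> F] --> enorm (0 : 'rV[R]_m).
  apply: (@continuous_cvg _ _ _ F FF (fun z => g z - l) (@enorm R m) 0).
    exact: enorm_continuous.
  by rewrite -(subrr l); apply: cvgB => //; exact: cvg_cst.
rewrite enorm0 => /cvgrPdist_lt/(_ e e0); apply: filterS => z.
by rewrite sub0r normrN ger0_norm ?enorm_ge0.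
Qed.

Lemma cvg_of_enormB (Z : Type) (F : set_system Z) {FF : Filter F}
    (g : Z -> 'rV[R]_m) (l : 'rV[R]_m) :
  (forall e : R, 0 < e -> \forall z \near F, enorm (g z - l) < e) -> g @ F --> l.
Proof.
move=> gl; apply/cvg_ballP => e e0; apply: filterS (gl e e0) => z gz.
split=> // i j; rewrite /ball/= (ord1 i).
have := coord_le_enorm (g z - l) j; rewrite !mxE distrC => /le_lt_trans; exact.
Qed.

Lemma compact_eball (r : R) : compact (@eball R m r).
Proof.
apply: bounded_closed_compact; last first.
  rewrite [eball r](_ : _ = @enorm R m @^-1` [set x | x <= r]) //.
  by apply: closed_comp (@closed_le _ r) => u _; exact: enorm_continuous.
exists r; split; first exact: num_real.
move=> x rx u /= ur.
rewrite [leLHS]/Num.norm/= mx_normrE; apply/bigmax_leP; split.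
  by rewrite (le_trans _ (ltW rx))// (le_trans _ ur)// enorm_ge0.
move=> [i j] _ /=; rewrite (ord1 i) (le_trans (coord_le_enorm _ _))//.
exact: le_trans ur (ltW rx).
Qed.

End EuclideanTopology.

Lemma cvg_into_within (Z X : Type) (F : set_system Z) {FF : Filter F} (g : Z -> X)
    (G : set_system X) (A : set X) :
  g @ F --> G -> (\forall z \near F, A (g z)) -> g @ F --> within A G.
Proof. by move=> gG gA P /gG; apply: filterS2 gA => z Az; apply. Qed.

(** * Convergence of the parametrization along a filter *)

Section ParamContinuity.
Variables (R : realType) (n : nat) (Z : Type) (F : set_system Z).
Context {FF : Filter F}.
Variables (C lam : Z -> R) (phi : Z -> 'rV[R]_n -> R) (a : Z -> 'rV[R]_n.+1).
Variables (C0 lam0 : R) (phi0 : 'rV[R]_n -> R) (a0 : 'rV[R]_n.+1).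
Hypothesis adm : \forall z \near F, admissible (C z) (phi z) (lam z).
Hypothesis adm0 : admissible C0 phi0 lam0.
Hypothesis cvgC : C z @[z --> F] --> C0.
Hypothesis cvglam : lam z @[z --> F] --> lam0.
Hypothesis cvgphi : forall p, phi z p @[z --> F] --> phi0 p.
Hypothesis cvga : a z @[z --> F] --> a0.

Let rad z := radius (C z) (phi z) (lam z).
Let rad0 := radius C0 phi0 lam0.

Lemma cvg_radius : rad z @[z --> F] --> rad0.
Proof.
apply: cvgD => //.
apply: (@continuous2_cvg _ _ _ _ F FF (fun z => `|lam z|) (fun z => `|phi z 0|) Num.max).
- exact: (@max_continuous _ R (`|lam0|, `|phi0 0|)).
- exact: cvg_norm.
- by apply: cvg_norm; exact: cvgphi.
Qed.

Let M := rad0 + 1.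

Let rad_leM : \forall z \near F, rad z <= M.
Proof.
have /cvgrPdist_le/(_ 1 ltr01) := cvg_radius; apply: filterS => z.
by rewrite ler_norml /M => /andP[+ _]; lra.
Qed.

Let M_gt0 : 0 < M.
Proof. by case: adm0 => _ h _ _; rewrite ltr_wpDl// addr_ge0// le_max normr_ge0. Qed.

Lemma cvg_supp_neg (s : R) p : 0 < s ->
  supp (phi z) (lam z) (vcons (- s) p) @[z --> F] --> supp phi0 lam0 (vcons (- s) p).
Proof.
move=> s0; rewrite (supp_neg adm0)//.
have : s * phi z (s^-1 *: p) @[z --> F] --> s * phi0 (s^-1 *: p) by apply: cvgMr; exact: cvgphi.
apply: cvg_trans; apply: near_eq_cvg.
by apply: filterS adm => z A; rewrite (supp_neg A).
Qed.

Lemma cvg_supp_zero p :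
  supp (phi z) (lam z) (vcons 0 p) @[z --> F] --> supp phi0 lam0 (vcons 0 p).
Proof.
apply/cvgrPdist_le => e e0.
(* One third of [e] goes to each change of head from 0 to [- s], and one third to convergence at
   head [- s]. *)
have s0 : 0 < e / (3 * M) by rewrite divr_gt0// mulr_gt0.
have e3 : 0 < e / 3 by rewrite divr_gt0.
have /cvgrPdist_le/(_ _ e3) := cvg_supp_neg (p := p) s0.
have [A rM] := (adm, rad_leM); move: A rM; apply: filterS3 => z A rM.
have := supp_zero_approx A p (ltW s0); have := supp_zero_approx adm0 p (ltW s0).
have : rad z * (e / (3 * M)) <= M * (e / (3 * M)) by rewrite ler_wpM2r// ltW.
have : rad0 * (e / (3 * M)) <= M * (e / (3 * M)) by rewrite ler_wpM2r ?(ltW s0)// lerDl.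
have -> : M * (e / (3 * M)) = e / 3 by field; exact: lt0r_neq0.
rewrite !ler_norml -/rad0 -/(rad z) => h1 h2 /andP[h3 h4] /andP[h5 h6] /andP[h7 h8].
apply/andP; split; lra.
Qed.

Lemma cvg_supp u : supp (phi z) (lam z) u @[z --> F] --> supp phi0 lam0 u.
Proof.
have [u0|u0] := ltP (vhead u) 0.
  by rewrite -(vcons_eta u) -[vhead u]opprK; apply: cvg_supp_neg; lra.
rewrite -(vcons_eta u) (supp_pos adm0)//.
have : supp (phi z) (lam z) (vcons 0 (vtail u)) + lam z * vhead u @[z --> F] -->
    supp phi0 lam0 (vcons 0 (vtail u)) + lam0 * vhead u.
  by apply: cvgD; [exact: cvg_supp_zero|exact: cvgMl].
apply: cvg_trans; apply: near_eq_cvg.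
by apply: filterS adm => z A; rewrite (supp_pos A (vtail u) u0).
Qed.

(** Pointwise convergence under a common Lipschitz constant is uniform on the compact unit ball, and
    homogeneity extends the bound to all [u]. The covering form of compactness suits an arbitrary
    filter. *)
Lemma near_supp_dist (e : R) : 0 < e -> \forall z \near F,
  forall u, `|supp (phi z) (lam z) u - supp phi0 lam0 u| <= e * enorm u.
Proof.
move=> e0; have [+ _] := compact_near_coveringP (@eball R n.+1 1).
move=> /(_ (@compact_eball R n.+1 1)) cov.
have e3 : 0 < e / 3 by rewrite divr_gt0.
have d0 : 0 < e / (3 * M) by rewrite divr_gt0// mulr_gt0.
have : \forall z \near F,
    @eball R n.+1 1 `<=` (fun u => `|supp (phi z) (lam z) u - supp phi0 lam0 u| <= e).
  apply: cov => u _.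
  (* The two Lipschitz bounds between [u] and [v] and the convergence at [u] contribute [e / 3]
     each. *)
  exists ([set v | enorm (v - u) < e / (3 * M)],
    [set z | [/\ admissible (C z) (phi z) (lam z), rad z <= M &
      `|supp phi0 lam0 u - supp (phi z) (lam z) u| <= e / 3]]).
    split=> /=; first exact: (@cvg_enormB _ _ _ (nbhs u) _ (fun v => v) u).
    have /cvgrPdist_le/(_ _ e3) := cvg_supp (u := u).
    by have [A rM] := (adm, rad_leM); move: A rM; apply: filterS3.
  move=> [v z] /= [vu [A rM uz]].
  have h1 := supp_lipf A v u; have h2 := supp_lipf adm0 u v.
  have : M * enorm (v - u) <= e / 3.
    have -> : e / 3 = M * (e / (3 * M)) by field; exact: lt0r_neq0.
    by rewrite ler_wpM2l ?ltW.
  have : rad z * enorm (v - u) <= M * enorm (v - u) by rewrite ler_wpM2r// enorm_ge0.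
  have : rad0 * enorm (v - u) <= M * enorm (v - u) by rewrite ler_wpM2r ?enorm_ge0// lerDl.
  move: h1 h2 uz; rewrite (enormBC u v) -/rad0 -/(rad z) !ler_norml.
  move=> /andP[h1 h2] /andP[h3 h4] /andP[h5 h6] h7 h8 h9; apply/andP; split; lra.
apply: filterS2 adm => z A near u.
have [->|u0] := eqVneq u 0.
  rewrite (sublin0 (supp_sublin A)) (sublin0 (supp_sublin adm0)).
  by rewrite subrr normr0 enorm0 mulr0.
have nu : 0 < enorm u.
  by rewrite lt_def enorm_ge0 andbT; apply: contra_neq u0 => /enorm_eq0.
have := near ((enorm u)^-1 *: u); rewrite /eball/= enormZ ger0_norm ?invr_ge0 ?(ltW nu)//.
rewrite mulVf ?gt_eqF// => /(_ (lexx _)).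
rewrite (supp_sublin A).2 ?(supp_sublin adm0).2 ?invr_ge0 ?(ltW nu)//.
rewrite -mulrBr normrM ger0_norm ?invr_ge0 ?(ltW nu)// ler_pdivrMl// mulrC//.
Qed.

Lemma cvg_param : param (C z) (phi z) (lam z) (a z) @[z --> F] --> param C0 phi0 lam0 a0.
Proof.
apply: cvg_of_enormB => e e0.
have K0 : 0 < 10 * (n%:R + 1) :> R by rewrite mulr_gt0// ltr_wpDl.
have d0 : 0 < e / (10 * (n%:R + 1)) / 2 by rewrite !divr_gt0.
have : rad z *: a z @[z --> F] --> rad0 *: a0 by apply: cvgZ => //; exact: cvg_radius.
move=> /cvg_enormB/(_ d0).
have [A sd] := (adm, near_supp_dist d0); move: A sd; apply: filterS3 => z A sd az.
apply: le_lt_trans (param_dist _ _ A adm0 (ltW d0) sd) _.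
by rewrite mulrC -ltr_pdivlMr// [ltRHS]splitr ltrD2l.
Qed.

End ParamContinuity.

(** * Final estimates and the theorem *)

Section Assembly.
Variables (R : realType) (n : nat).

Lemma vhead_continuous : continuous (@vhead R n).
Proof. by move=> u; exact: (@coord_continuous R 1 n.+1 ord0 ord0 u). Qed.

Lemma vtail_continuous : continuous (@vtail R n).
Proof.
move=> u; apply: (@cvg_of_enormB _ _ _ (nbhs u) _ (@vtail R n) (vtail u)) => e e0.
apply: filterS (@cvg_enormB _ _ _ (nbhs u) _ (fun v => v) u e (@cvg_id _ _) e0) => v.
by apply: le_lt_trans; rewrite -vtailB; exact: enorm_vtail.
Qed.

Lemma radius_dist (C C' lam lam' e : R) (phi phi' : 'rV[R]_n -> R) :
  `|lam - lam'| <= e -> `|phi 0 - phi' 0| <= e ->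
  `|radius C phi lam - radius C' phi' lam'| <= e + `|C - C'|.
Proof.
move=> le1 le2; rewrite /radius opprD addrACA (le_trans (ler_normD _ _))// lerD2r.
have := le_trans (ler_dist_dist lam lam') le1.
have := le_trans (ler_dist_dist (phi 0) (phi' 0)) le2.
rewrite !ler_norml => /andP[h1 h2] /andP[h3 h4].
by rewrite /Order.max; case: ltP => ?; case: ltP => ?; apply/andP; split; lra.
Qed.

Lemma enorm_scaleB_le (s s' : R) (a a' : 'rV[R]_n.+1) : enorm a <= 1 ->
  enorm (s *: a - s' *: a') <= `|s - s'| + `|s'| * enorm (a - a').
Proof.
move=> a1; apply: le_trans (enormB_triangle (s' *: a) _ _) _.
rewrite -scalerBl -scalerBr !enormZ lerD2r -[leRHS]mulr1.
by rewrite ler_wpM2l.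
Qed.

End Assembly.

Unset Implicit Arguments.

Theorem theorem3p4 (R : realType) (T : R) (n : nat)
  (H : R -> 'rV[R]_n -> 'rV[R]_n -> R)
  (c : R -> R) (k : R -> R -> R) (lam : R -> 'rV[R]_n -> R)
  (T_gt0 : 0 < T) (n_ge1 : (1 <= n)%N)
  (H_meas : forall x p, lmeasurable `[0, T] (fun t => H t x p))
  (H_cont : forall t, 0 <= t <= T ->
    continuous (fun z : 'rV[R]_n * 'rV[R]_n => H t z.1 z.2))
  (H_conv : forall t x, 0 <= t <= T -> convex_function setT (H t x))
  (c_meas : lmeasurable `[0, T] c)
  (c_ge0 : forall t, 0 <= t <= T -> 0 <= c t)
  (H_lip_p : forall t x p q, 0 <= t <= T ->
    `|H t x p - H t x q| <= c t * (1 + enorm x) * enorm (p - q))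
  (k_meas : forall r, 0 < r -> lmeasurable `[0, T] (k r))
  (k_ge0 : forall r t, 0 < r -> 0 <= t <= T -> 0 <= k r t)
  (H_lip_x : forall r t x y p, 0 < r -> 0 <= t <= T ->
    eball r x -> eball r y ->
    `|H t x p - H t y p| <= k r t * (1 + enorm p) * enorm (x - y))
  (lam_meas : forall x, lmeasurable `[0, T] (fun t => lam t x))
  (lam_cont : forall t, 0 <= t <= T -> continuous (lam t))
  (lam_bound : forall t x v, 0 <= t <= T ->
    edom (fenchel (H t x)) v -> (fenchel (H t x) v <= (lam t x)%:E)%E)
  (lam_lip : forall r t x y, 0 < r -> 0 <= t <= T ->
    eball r x -> eball r y ->
    `|lam t x - lam t y| <= k r t * enorm (x - y)) :
  let B : set 'rV[R]_n.+1 := eball 1 in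
  let omega r t := `|lam t 0| + `|H t 0 0| + c t * (2 + r) in
  exists (f : R -> 'rV[R]_n -> 'rV[R]_n.+1 -> 'rV[R]_n)
         (l : R -> 'rV[R]_n -> 'rV[R]_n.+1 -> R),
    (forall x a, B a -> lmeasurable_rV `[0, T] (fun t => f t x a)) /\
    (forall x a, B a -> lmeasurable `[0, T] (fun t => l t x a)) /\
    (forall t, 0 <= t <= T ->
      {within setT `*` B,
        continuous (fun z : 'rV[R]_n * 'rV[R]_n.+1 => f t z.1 z.2)}) /\
    (forall t, 0 <= t <= T ->
      {within setT `*` B,
        continuous (fun z : 'rV[R]_n * 'rV[R]_n.+1 => l t z.1 z.2)}) /\
    (forall t x p, 0 <= t <= T ->
      (H t x p)%:E =
        ereal_sup [set (dotv p (f t x a) - l t x a)%:E | a in B]) /\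
    (forall t x, 0 <= t <= T -> f t x @` B = edom (fenchel (H t x))) /\
    (* (A1) *)
    (forall r t x y a b, 0 < r -> 0 <= t <= T ->
      eball r x -> eball r y -> B a -> B b ->
      enorm (f t x a - f t y b) <=
        10 * (n%:R + 1) * (omega r t + 3 * (1 + r) * k r t + 1) *
          (enorm (x - y) + enorm (a - b)) /\
      `|l t x a - l t y b| <=
        10 * (n%:R + 1) * (omega r t + 3 * (1 + r) * k r t + 1) *
          (enorm (x - y) + enorm (a - b))) /\
    (* (A2) *)
    (forall t x a, 0 <= t <= T -> B a ->
      enorm (f t x a) <= c t * (1 + enorm x)) /\
    (* (A3) *)
    (forall t x, 0 <= t <= T ->
      egph (fenchel (H t x)) `<=` [set (f t x a, l t x a) | a in B]) /\
    (* (A4) *)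
    ({within `[0, T] `*` setT `*` setT,
       continuous (fun z : R * 'rV[R]_n * 'rV[R]_n => H z.1.1 z.1.2 z.2)} ->
     {within `[0, T] `*` setT,
       continuous (fun z : R * 'rV[R]_n => lam z.1 z.2)} ->
     {within `[0, T], continuous c} ->
     {within `[0, T] `*` setT `*` B,
       continuous (fun z : R * 'rV[R]_n * 'rV[R]_n.+1 => f z.1.1 z.1.2 z.2)} /\
     {within `[0, T] `*` setT `*` B,
       continuous (fun z : R * 'rV[R]_n * 'rV[R]_n.+1 => l z.1.1 z.1.2 z.2)}).
Proof.
move=> B omega.
pose C t (x : 'rV[R]_n) := c t * (1 + enorm x).
(* The tail of this map will be [f] and its head [l]; both inherit its estimates. *)
pose e t x := param (C t x) (H t x) (lam t x).
have n1 (x : 'rV[R]_n) : 0 <= 1 + enorm x by rewrite addr_ge0 ?enorm_ge0.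
have inT t : [set` `[0, T]] t = (0 <= t <= T) :> Prop by rewrite /= in_itv.
have adm t x : 0 <= t <= T -> admissible (C t x) (H t x) (lam t x).
  move=> tT; apply: admissible_fenchel.
  - by rewrite mulr_ge0// c_ge0.
  - exact: H_conv.
  - by move=> p q; exact: H_lip_p.
  - by move=> v; exact: lam_bound.
have me x a i : lmeasurable `[0, T] (fun t => e t x a ord0 i).
  apply: measurable_param => //.
  - exact: measurable_funM.
  - exact: lam_meas.
  - by move=> p; exact: H_meas.
  - by move=> t; rewrite inT => tT; exact: adm.
have e_dist r t x y a b : 0 < r -> 0 <= t <= T -> eball r x -> eball r y -> B a -> B b ->
    enorm (e t x a - e t y b) <=
    10 * (n%:R + 1) * (omega r t + 3 * (1 + r) * k r t + 1) * (enorm (x - y) + enorm (a - b)).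
  move=> r0 tT xr yr a1 b1.
  have k0 := k_ge0 r t r0 tT; have c0 := c_ge0 t tT.
  set X := enorm (x - y); set Y := enorm (a - b).
  have X0 : 0 <= X by exact: enorm_ge0.
  have Y0 : 0 <= Y by exact: enorm_ge0.
  have kX0 : 0 <= k r t * X by rewrite mulr_ge0.
  have lk : `|lam t x - lam t y| <= k r t * X by exact: lam_lip.
  have Hk p : `|H t x p - H t y p| <= k r t * X * (1 + enorm p).
    by rewrite mulrAC; exact: H_lip_x.
  have sd u : `|supp (H t x) (lam t x) u - supp (H t y) (lam t y) u| <= 2 * (k r t * X) * enorm u.
    by apply: supp_dist => //; exact: adm.
  have Hk0 : `|H t x 0 - H t y 0| <= k r t * X.
    by have := Hk 0; rewrite enorm0 addr0 mulr1.
  have CX : `|C t x - C t y| <= c t * X.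
    rewrite /C -mulrBr normrM ger0_norm// ler_wpM2l// opprD addrACA subrr add0r ler_norml.
    have := enormB_triangle y x 0; have := enormB_triangle x y 0.
    by rewrite !subr0 (enormBC y x) -/X => ? ?; apply/andP; split; lra.
  have rad1 := radius_dist (C t x) (C t y) lk Hk0.
  (* The maximum in [radius] is bounded by a sum, with values at [y] compared to those at 0. As
     [C t y] is at most [c t * (1 + r)] and [omega] contains [c t * (2 + r)], one [c t] is left
     over. *)
  have rad2 : radius (C t y) (H t y) (lam t y) <= omega r t - c t + k r t * r.
    have zr : eball r (0 : 'rV[R]_n) by rewrite /eball/= enorm0 ltW.
    have ly := lam_lip r t y 0 r0 tT yr zr.
    have Hy := H_lip_x r t y 0 0 r0 tT yr zr.
    move: ly Hy; rewrite subr0 enorm0 addr0 mulr1.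
    have : k r t * enorm y <= k r t * r by rewrite ler_wpM2l.
    have : c t * enorm y <= c t * r by rewrite ler_wpM2l.
    have := lerB_dist (lam t y) (lam t 0); have := lerB_dist (H t y 0) (H t 0 0).
    have := normr_ge0 (lam t 0); have := normr_ge0 (H t 0 0).
    rewrite /radius /omega /C => h1 h2 h3 h4 h5 h6 h7 h8.
    rewrite -lerBrDr ge_max; apply/andP; split; lra.
  have rad0 : 0 <= radius (C t y) (H t y) (lam t y).
    by rewrite addr_ge0 ?le_max ?normr_ge0// mulr_ge0.
  have a1' : enorm a <= 1 by exact: a1.
  have := enorm_scaleB_le (radius (C t x) (H t x) (lam t x))
    (radius (C t y) (H t y) (lam t y)) b a1'.
  rewrite (ger0_norm rad0) -/Y => sc.
  have e2 : 0 <= 2 * (k r t * X) by rewrite mulr_ge0.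
  have := param_dist a b (adm t x tT) (adm t y tT) e2 sd.
  move/le_trans; apply; rewrite -[leRHS]mulrA ler_wpM2l ?mulr_ge0 ?addr_ge0//.
  (* The coefficient of [X] is [3 * k r t + c t]: 2 from the support functions, the rest from the
     change of radius. This inequality absorbs its [c t]. *)
  have om : 2 * c t <= omega r t.
    have : 0 <= c t * r by rewrite mulr_ge0// ltW.
    have := normr_ge0 (lam t 0); have := normr_ge0 (H t 0 0); rewrite /omega; lra.
  have kr0 : 0 <= k r t * r by rewrite mulr_ge0// ltW.
  have : radius (C t y) (H t y) (lam t y) * Y <= (omega r t - c t + k r t * r) * Y.
    by rewrite ler_wpM2r.
  have : (3 * k r t + c t) * X <= (omega r t + 3 * (1 + r) * k r t + 1) * X.
    by rewrite ler_wpM2r//; lra.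
  have : (omega r t - c t + k r t * r) * Y <= (omega r t + 3 * (1 + r) * k r t + 1) * Y.
    by rewrite ler_wpM2r//; lra.
  lra.
(* The arbitrary filter serves both continuity in [(x, a)] at fixed [t] and joint continuity for
   (A4). *)
have cvg_e t0 x0 a0 (Z : Type) (F : set_system Z) (FF : Filter F) (t : Z -> R)
    (x : Z -> 'rV[R]_n) (a : Z -> 'rV[R]_n.+1) : 0 <= t0 <= T ->
    (\forall z \near F, 0 <= t z <= T) -> c (t z) @[z --> F] --> c t0 ->
    x z @[z --> F] --> x0 -> a z @[z --> F] --> a0 ->
    lam (t z) (x z) @[z --> F] --> lam t0 x0 ->
    (forall p, H (t z) (x z) p @[z --> F] --> H t0 x0 p) ->
    e (t z) (x z) (a z) @[z --> F] --> e t0 x0 a0.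
  move=> t0T tT ct xx aa lt Ht.
  apply: (@cvg_param _ _ _ F FF (fun z => C (t z) (x z)) (fun z => lam (t z) (x z))
    (fun z => H (t z) (x z)) a) => //.
  - move: tT; apply: filterS => z tz; exact: adm.
  - exact: adm.
  - apply: cvgM => //; apply: cvgD; first exact: cvg_cst.
    by apply: (@continuous_cvg _ _ _ F FF x (@enorm R n) x0) => //; exact: enorm_continuous.
have cont_slice t : 0 <= t <= T -> forall z0, (setT `*` B) z0 ->
    e t z.1 z.2 @[z --> within (setT `*` B) (nbhs z0)] --> e t z0.1 z0.2.
  move=> tT z0 _; apply: cvg_within_filter.
  apply: (@cvg_e t z0.1 z0.2 _ (nbhs z0) _ (fun=> t) fst snd) => //.
  - exact: nearW.
  - exact: cvg_cst.
  - exact: cvg_fst.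
  - exact: cvg_snd.
  - by apply: (@continuous_cvg _ _ _ (nbhs z0) _ fst (lam t) z0.1); [exact: lam_cont|exact: cvg_fst].
  - move=> p; apply: (@continuous_cvg _ _ _ (nbhs z0) _ (fun z => (z.1, p))
      (fun z => H t z.1 z.2) (z0.1, p)); first exact: H_cont.
    apply: (@cvg_pair _ _ _ (nbhs z0) (nbhs z0.1) (nbhs p) _ _ _ fst (fun=> p)); first exact: cvg_fst.
    exact: cvg_cst.
exists (fun t x a => vtail (e t x a)), (fun t x a => vhead (e t x a)).
split.
  move=> x a _; apply: measurable_fun_rV => i.
  rewrite (_ : (fun t => _) = (fun t => e t x a ord0 (lift ord0 i))); first exact: me.
  by apply/funext => t; rewrite mxE.
split; first by move=> x a _; exact: me.
split.
  move=> t tT; apply/subspace_continuousP => z0 z0B.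
  by apply: (continuous_cvg _ (@vtail_continuous R n _)); exact: cont_slice.
split.
  move=> t tT; apply/subspace_continuousP => z0 z0B.
  by apply: (continuous_cvg _ (@vhead_continuous R n _)); exact: cont_slice.
split; first by move=> t x p tT; exact: param_sup (adm t x tT) p.
split; first by move=> t x tT; exact: param_dom (adm t x tT).
split.
  move=> r t x y a b r0 tT xr yr a1 b1; have ed := e_dist r t x y a b r0 tT xr yr a1 b1.
  rewrite -vtailB -vheadB; split.
    exact: le_trans (enorm_vtail _) ed.
  exact: le_trans (normr_vhead _) ed.
split; first by move=> t x a tT _; exact: enorm_param (adm t x tT) a.
split.
  move=> t x tT [v s] /= vs; have [a a1 ea] := param_graph (adm t x tT) vs.
  by exists a => //; rewrite /e ea vtail_cons vhead_cons.
move=> cH cl cc.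
have cont_e z0 : (`[0, T] `*` setT `*` B) z0 ->
    e z.1.1 z.1.2 z.2 @[z --> within (`[0, T] `*` setT `*` B) (nbhs z0)] -->
    e z0.1.1 z0.1.2 z0.2.
  set F := within _ _; move=> [[t0T _] _].
  have FS : \forall z \near F, (`[0, T] `*` setT `*` B) z by exact: withinT.
  have cz1 : z.1 @[z --> F] --> z0.1 by apply: cvg_within_filter; exact: cvg_fst.
  have cz2 : z.2 @[z --> F] --> z0.2 by apply: cvg_within_filter; exact: cvg_snd.
  have ct : z.1.1 @[z --> F] --> z0.1.1 by apply: (cvg_comp _ _ cz1); exact: cvg_fst.
  have cx : z.1.2 @[z --> F] --> z0.1.2 by apply: (cvg_comp _ _ cz1); exact: cvg_snd.
  apply: cvg_e => //.
  - by move: FS; apply: filterS => z [[+ _] _]; rewrite inT.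
  (* Continuity is assumed only relative to [0,T], so convergence is first lifted to the restricted
     neighbourhood filter. *)
  - have ct' : z.1.1 @[z --> F] --> within `[0, T] (nbhs z0.1.1).
      by apply: cvg_into_within => //; move: FS; apply: filterS => z [[]].
    by move/subspace_continuousP : cc => /(_ _ t0T); exact: (cvg_comp _ _ ct').
  - have cz' : z.1 @[z --> F] --> within (`[0, T] `*` setT) (nbhs z0.1).
      by apply: cvg_into_within => //; move: FS; apply: filterS => z [].
    by move/subspace_continuousP : cl => /(_ z0.1 (conj t0T I)); exact: (cvg_comp _ _ cz').
  - move=> p; have cp : (z.1, p) @[z --> F] --> within (`[0, T] `*` setT `*` setT) (nbhs (z0.1, p)).
      apply: cvg_into_within.
        by apply: (@cvg_pair _ _ _ F (nbhs z0.1) (nbhs p) _ _ _ fst (fun=> p)) => //; exact: cvg_cst.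
      by move: FS; apply: filterS => z [[]].
    move/subspace_continuousP : cH => /(_ (z0.1, p) (conj (conj t0T I) I)).
    exact: (cvg_comp _ _ cp).
split; apply/subspace_continuousP => z0 z0S.
- by apply: (continuous_cvg _ (@vtail_continuous R n _)); exact: cont_e.
- by apply: (continuous_cvg _ (@vhead_continuous R n _)); exact: cont_e.
Qed.
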